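(* Let $\theta\leq\frac14$ be real, let $h,\tau,\hbar,\rho_\infty,B_\infty>0$ and $V_\infty\in\mathbb{R}$, and let $c_{0\theta},\varkappa_\theta,\mu_\theta,\tilde\alpha_\theta,\hat a$, $R^m(\varkappa,\mu)$ and the kernel $c_{0D}R_D^m$ of the semi-discrete transparent boundary condition be as defined in the context. Then for all $m\geq0$ $$\left|c_{0\theta}R^m(\varkappa_\theta,\mu_\theta)-c_{0D}R_D^m\right|\leq\left(\frac{3\sqrt2}{|\tilde\alpha_\theta|}+\frac{1}{|2m-1|\left(|\tilde\alpha_\theta|^{1/2}+\sqrt2\right)}\right)(1-4\theta)h^2|\hat a|^{3/2}.$$ In particular, for any fixed $\tau_0>0$ (and fixed $\hbar,\rho_\infty,B_\infty,V_\infty$), $$\sup_{m\geq0}\left|c_{0\theta}R^m(\varkappa_\theta,\mu_\theta)-c_{0D}R_D^m\right|=O\left((1-4\theta)\frac{h^2}{\tau^{3/2}}\right)\quad\text{as}\ (1-4\theta)\frac{h^2}{\tau}\to0\ \text{and}\ \tau\leq\tau_0 .$$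
   Context: For $z\in\mathbb{C}\setminus\{0\}$, $\arg z$ is defined up to $2\pi k$ with any integer $k$, whereas $\arg_0z\in[0,2\pi)$. Put $$\hat a=\hat a_0+i\hat a_1,\quad \hat a_0=\frac{V_\infty}{\hbar^2B_\infty},\quad \hat a_1=\frac{2\rho_\infty}{\tau\hbar B_\infty}>0,\qquad \tilde\alpha_\theta=2+(1-4\theta)h^2\hat a,$$ $$\hat\alpha_\theta=2\hat a+(1-4\theta)h^2\hat a^2=\hat a\,\tilde\alpha_\theta\neq0,\qquad \hat\beta_\theta=2\hat a_0+(1-4\theta)h^2|\hat a|^2,$$ $$c_{0\theta}=-\frac{|\hat\alpha_\theta|^{1/2}}{2}e^{-i(\arg_0\hat\alpha_\theta)/2},\qquad \varkappa_\theta=-e^{i\arg\hat\alpha_\theta},\qquad \mu_\theta=\frac{\hat\beta_\theta}{|\hat\alpha_\theta|}.$$ With the Legendre polynomials $P_m$ extended by $P_m=0$ for $m<0$, let $R^m(\varkappa,\mu)=-\frac{\varkappa^m}{2m-1}[P_m(\mu)-P_{m-2}(\mu)]$ for $m\geq0$. The sequence $c_{0\theta}R^m(\varkappa_\theta,\mu_\theta)$ is the kernel of the discrete convolution operator in the discrete transparent boundary condition. Kernel $c_{0D}R_D^m$ of the semi-discrete transparent boundary condition. Let $t_m=m\tau$, $\overline{\partial}_tY^m=\frac{Y^m-Y^{m-1}}{\tau}$, $\overline{s}_tY^m=\frac{Y^{m-1}+Y^m}{2}$ for $m\geq1$, $D=\frac{\partial}{\partial x}$, and fix $X>0$. Given $\Phi=\{\Phi^m\}_{m\geq0}\subset\mathbb{C}$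 with $\Phi^0=0$, let $\Psi^m(x)$, $x\geq X$, be the solution of $$i\hbar\rho_\infty\overline{\partial}_t\Psi^m=-\frac{\hbar^2}{2}B_\infty D^2\overline{s}_t\Psi^m+V_\infty\overline{s}_t\Psi^m,\quad m\geq1,$$ with $\Psi^0(x)=0$, $\Psi^m(X)=\Phi^m$ and $\Psi^m(x)\to0$ as $x\to+\infty$. Then $(D\overline{s}_t\Psi)^m(X)$ is a discrete convolution $$(D\overline{s}_t\Psi)^m(X)=c_{0D}\sum_{l=0}^mR_D^l\Phi^{m-l},\quad m\geq1,\qquad\text{with}\ R_D^0=1,$$ for all such $\Phi$, and this defines the constant $c_{0D}$ and the sequence $R_D^m$ (independent of $h$). *)

(* Defs.v *)
From Stdlib Require Import Reals Lra Lia ZArith ClassicalEpsilon.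
From Coquelicot Require Import Coquelicot.
Open Scope R_scope.

Definition cis (phi : R) : C := (cos phi, sin phi).

(** The argument in [0, 2 PI); see [arg0_spec].  The value at 0 is irrelevant. *)
Definition arg0 (z : C) : R :=
  if Rle_dec 0 (Im z) then acos (Re z / Cmod z)
  else 2 * PI - acos (Re z / Cmod z).

Lemma arg0_spec (z : C) : z <> RtoC 0 ->
  0 <= arg0 z < 2 * PI /\ z = Cmult (RtoC (Cmod z)) (cis (arg0 z)).
Proof.
  intros Hz.
  assert (Hm : 0 < Cmod z) by (now apply Cmod_gt_0).
  destruct z as [a b].
  assert (Hsq : Cmod (a, b) * Cmod (a, b) = a * a + b * b).
  { unfold Cmod; simpl fst; simpl snd; rewrite sqrt_sqrt; nra. }
  set (M := Cmod (a, b)) in *.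
  assert (Hb : -1 <= a / M <= 1).
  { split.
    - apply (Rmult_le_reg_r M); [exact Hm|]. unfold Rdiv.
      rewrite Rmult_assoc, Rinv_l by lra. nra.
    - apply (Rmult_le_reg_r M); [exact Hm|]. unfold Rdiv.
      rewrite Rmult_assoc, Rinv_l by lra. nra. }
  assert (Hs : sqrt (1 - (a / M)²) = Rabs b / M).
  { assert (Hp : 0 <= Rabs b / M)
      by (apply Rdiv_le_0_compat; [apply Rabs_pos | exact Hm]).
    rewrite <- (sqrt_Rsqr (Rabs b / M)) by exact Hp.
    f_equal. rewrite !Rsqr_div', <- Rsqr_abs. unfold Rsqr.
    replace (b * b) with (M * M - a * a) by lra. field. lra. }
  pose proof (acos_bound (a / M)) as Ha. pose proof PI_RGT_0 as HPI.
  unfold arg0, cis, Cmult, RtoC. cbn [Re Im fst snd]. fold M.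
  destruct (Rle_dec 0 b) as [Hb0 | Hb0].
  - split; [lra|].
    rewrite cos_acos, sin_acos, Hs, Rabs_pos_eq by lra.
    f_equal; field; lra.
  - split.
    + split; [lra|]. destruct (Req_dec (acos (a / M)) 0) as [E|E]; [exfalso|lra].
      assert (S := sin_acos _ Hb). rewrite E, sin_0, Hs in S.
      assert (0 < Rabs b / M)
        by (apply Rdiv_lt_0_compat; [apply Rabs_pos_lt; lra | exact Hm]).
      lra.
    + replace (2 * PI - acos (a / M)) with (- acos (a / M) + 2 * INR 1 * PI)
        by (simpl; ring).
      rewrite cos_period, sin_period, cos_neg, sin_neg, cos_acos, sin_acos, Hs by lra.
      rewrite Rabs_left by lra. f_equal; field; lra.
Qed.

Definition ahat (hbar rho B V tau : R) : C :=
  (V / (hbar ^ 2 * B), 2 * rho / (tau * hbar * B)).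

Definition alpha_tilde (theta h : R) (a : C) : C :=
  (2 + RtoC ((1 - 4 * theta) * h ^ 2) * a)%C.

Definition alpha_hat (theta h : R) (a : C) : C :=
  (2 * a + RtoC ((1 - 4 * theta) * h ^ 2) * (a * a))%C.

Definition beta_hat (theta h : R) (a : C) : R :=
  2 * Re a + (1 - 4 * theta) * h ^ 2 * Cmod a ^ 2.

Definition c0 (theta h : R) (a : C) : C :=
  let alpha := alpha_hat theta h a in
  (RtoC (- (sqrt (Cmod alpha) / 2)) * cis (- (arg0 alpha / 2)))%C.

Definition varkappa (theta h : R) (a : C) : C :=
  (- cis (arg0 (alpha_hat theta h a)))%C.

Definition mu (theta h : R) (a : C) : R :=
  beta_hat theta h a / Cmod (alpha_hat theta h a).

(** Legendre polynomials, by Bonnet's recursion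
    (m + 2) P_{m+2} = (2 m + 3) x P_{m+1} - (m + 1) P_m. *)
Fixpoint Legendre (n : nat) (x : R) : R :=
  match n with
  | O => 1
  | S k =>
      match k with
      | O => x
      | S m => ((2 * INR m + 3) * x * Legendre k x - (INR m + 1) * Legendre m x)
               / (INR m + 2)
      end
  end.

Definition LegendreZ (k : Z) (x : R) : R :=
  if (k <? 0)%Z then 0 else Legendre (Z.to_nat k) x.

Definition Rker (kappa : C) (x : R) (m : nat) : C :=
  (- (kappa ^ m / RtoC (2 * INR m - 1))
   * RtoC (LegendreZ (Z.of_nat m) x - LegendreZ (Z.of_nat m - 2) x))%C.

(** Derivative along the half-line [X, +oo): one-sided at [X], and the usual
    [is_derive] at [x > X]. *)
Definition is_derive_ge (X : R) (f : R -> C) (x : R) (l : C) : Prop :=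
  filterdiff (K := R_AbsRing) (U := R_NormedModule) (V := C_R_NormedModule)
    f (within (fun y => X <= y) (locally x))
    (fun y : R => scal (V := C_R_NormedModule) y l).

(** [dt_bar] and [st_bar] are only meant for [m >= 1]. *)
Definition dt_bar (tau : R) (Y : nat -> R -> C) (m : nat) (x : R) : C :=
  ((Y m x - Y (pred m) x) / RtoC tau)%C.

Definition st_bar (Y : nat -> R -> C) (m : nat) (x : R) : C :=
  ((Y (pred m) x + Y m x) / 2)%C.

Definition sd_solution (hbar rho B V tau X : R)
    (Phi : nat -> C) (Psi : nat -> R -> C) : Prop :=
  (exists Y1 Y2 : nat -> R -> C,
     forall (m : nat) (x : R), (1 <= m)%nat -> X <= x ->
       is_derive_ge X (st_bar Psi m) x (Y1 m x) /\
       is_derive_ge X (Y1 m) x (Y2 m x) /\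
       (Ci * RtoC (hbar * rho) * dt_bar tau Psi m x
        = RtoC (- (hbar ^ 2 / 2 * B)) * Y2 m x
          + RtoC V * st_bar Psi m x)%C) /\
  (forall x : R, X <= x -> Psi O x = RtoC 0) /\
  (forall m : nat, Psi m X = Phi m) /\
  (forall m : nat, filterlim (Psi m) (Rbar_locally p_infty) (locally (RtoC 0))).

Definition is_sd_kernel (hbar rho B V tau X : R) (k : C * (nat -> C)) : Prop :=
  let (c, Rseq) := k in
  Rseq O = RtoC 1 /\
  forall (Phi : nat -> C) (Psi : nat -> R -> C),
    Phi O = RtoC 0 ->
    sd_solution hbar rho B V tau X Phi Psi ->
    forall m : nat, (1 <= m)%nat ->
      is_derive_ge X (st_bar Psi m) X
        (c * sum_n (fun l => Rseq l * Phi (m - l)%nat) m)%C.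

(** The kernel is the pair determined by [is_sd_kernel]; the operator [epsilon]
    yields no information about it unless such a pair is proved to exist. *)
Definition sd_kernel (hbar rho B V tau X : R) : C * (nat -> C) :=
  epsilon (inhabits (RtoC 0, fun _ => RtoC 0)) (is_sd_kernel hbar rho B V tau X).

Definition c0D (hbar rho B V tau X : R) : C :=
  fst (sd_kernel hbar rho B V tau X).

Definition RD (hbar rho B V tau X : R) : nat -> C :=
  snd (sd_kernel hbar rho B V tau X).

Definition kernel_error (theta h hbar rho B V tau X : R) (m : nat) : R :=
  let a := ahat hbar rho B V tau in
  Cmod (c0 theta h a * Rker (varkappa theta h a) (mu theta h a) m
        - c0D hbar rho B V tau X * RD hbar rho B V tau X m)%C.

(* Main.v *)
Require Import Defs.
From Stdlib Require Import Reals Lra Lia ZArith ClassicalEpsilon.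
From Coquelicot Require Import Coquelicot.
Open Scope R_scope.

(** With generating functions in time, the semi-discrete problem reads
    [((1 + z) / 2 * Psi)'' = (Cconj a + a z) Psi], so its decaying solutions satisfy
    [((1 + z) / 2 * Psi)' = g Psi] with [g = - sqrt ((1 + z) (Cconj a + a z) / 2)].  Since
    [R^m] is generated by [sqrt (1 - 2 mu varkappa z + varkappa^2 z^2)], the coefficients of
    [g] are the discrete kernel at [theta = 1 / 4].  The two kernels are then compared factor
    by factor: the moduli of [c0]; the phases, through the square root [w] of
    [alpha_tilde / |alpha_tilde|], where [|w^(2m-1) - 1| <= |2m - 1| |w - 1|] and the growing
    factor is absorbed by the [2m - 1] in the denominator of [R^m]; and the Legendre factor,
    whose derivative in [mu] is [- P_(m-1)], at most [1] in modulus. *)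

(** * One-sided derivatives *)

(** As [sd_kernel] is an [epsilon] choice, two facts are owed: some pair satisfies [is_sd_kernel],
    and all such pairs have the same products c R^m. The second needs an actual solution of the
    scheme for an impulse, since data without a solution would constrain nothing; each time level is
    built as a polynomial times one fixed decaying exponential. Generating functions are used
    formally, as coefficient sequences under [conv], and square roots enter through their squares
    and leading coefficients. The sign Re g_0 < 0 links the root to decay: a nonzero defect in the
    boundary condition would grow without bound, yet it is bounded, even though decay is assumed for
    Psi and not for its derivative. In the comparison the obstacle is the branch of the
    half-argument. For theta <= 1/4 both [a] and [alpha_tilde] lie in the closed upper half-plane,
    so their half-arguments add without wrapping around. The constant 3 sqrt 2 is 2 sqrt 2 from the
    phases plus sqrt 2 from the Legendre factor. *)

Lemma C_ext (a b : C) : Re a = Re b -> Im a = Im b -> a = b.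
Proof. destruct a, b; cbn; congruence. Qed.

(** The norm of [C_R_NormedModule] is [Cmod], and a point of the half-line is the only limit of its
    restricted neighbourhood filter, so the filter formulation reduces to epsilon and delta. *)
Lemma is_derive_ge_iff (X : R) (f : R -> C) (x : R) (l : C) : X <= x ->
  is_derive_ge X f x l <->
  (forall eps, 0 < eps -> exists d, 0 < d /\ forall y, X <= y -> Rabs (y - x) < d ->
     Cmod (f y - f x - RtoC (y - x) * l)%C <= eps * Rabs (y - x)).
Proof.
  intros Hx.
  assert (Hrem : forall y,
    @norm R_AbsRing C_R_NormedModule
      (minus (G := C_R_NormedModule) (minus (G := C_R_NormedModule) (f y) (f x))
        (scal (V := C_R_NormedModule) (minus (G := R_NormedModule) y x) l))
    = Cmod (f y - f x - RtoC (y - x) * l)%C).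
  { intros y.
    assert (N : forall z : C, @norm R_AbsRing C_R_NormedModule z = Cmod z).
    { intros z. unfold norm; cbn. unfold prod_norm, Cmod, norm; cbn. unfold abs; cbn.
      now rewrite !Rmult_1_r, <- !Rabs_mult, !Rabs_pos_eq by apply Rle_0_sqr. }
    rewrite N. f_equal. apply C_ext; destruct (f y), (f x), l; cbn; ring. }
  split.
  - intros [_ H] eps He.
    assert (Hlim : is_filter_lim (within (fun y => X <= y) (locally x)) x).
    { intros P [d Hd]. exists d. intros y Hy _. now apply Hd. }
    destruct (H x Hlim (mkposreal eps He)) as [d Hd].
    exists d. split; [apply cond_pos|]. intros y Hy Hyx.
    specialize (Hd y Hyx Hy). rewrite Hrem in Hd. exact Hd.
  - intros H. split.
    + apply is_linear_scal_l.
    + intros x' Hx'.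
      assert (x' = x) as ->.
      { destruct (Req_dec x' x) as [E | E]; [exact E | exfalso].
        assert (Hp : 0 < Rabs (x' - x) / 2) by (pose proof (Rabs_pos_lt (x' - x)); lra).
        destruct (Hx' (fun y => Rabs (y - x') < Rabs (x' - x) / 2)) as [d Hd].
        { exists (mkposreal _ Hp). intros y Hy. exact Hy. }
        specialize (Hd x (ball_center x d) Hx). cbn beta in Hd.
        rewrite Rabs_minus_sym in Hd. lra. }
      intros eps. destruct (H eps (cond_pos eps)) as [d [Hd1 Hd2]].
      exists (mkposreal d Hd1). intros y Hy Hy'.
      rewrite Hrem. exact (Hd2 y Hy' Hy).
Qed.

Lemma is_derive_ge_ext (X : R) (f g : R -> C) (x : R) (l : C) : X <= x ->
  (forall y, X <= y -> f y = g y) -> is_derive_ge X f x l -> is_derive_ge X g x l.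
Proof.
  intros Hx Hfg Hf. apply is_derive_ge_iff; [exact Hx|].
  rewrite is_derive_ge_iff in Hf by exact Hx. intros eps He.
  destruct (Hf eps He) as [d [Hd H]]. exists d. split; [exact Hd|].
  intros y Hy Hyx. rewrite <- !Hfg by assumption. now apply H.
Qed.

Lemma is_derive_ge_plus (X : R) (f g : R -> C) (x : R) (lf lg : C) : X <= x ->
  is_derive_ge X f x lf -> is_derive_ge X g x lg ->
  is_derive_ge X (fun y => f y + g y)%C x (lf + lg)%C.
Proof.
  intros Hx Hf Hg. apply is_derive_ge_iff; [exact Hx|].
  rewrite is_derive_ge_iff in Hf by exact Hx.
  rewrite is_derive_ge_iff in Hg by exact Hx. intros eps He.
  destruct (Hf (eps / 2)) as [d1 [Hd1 H1]]; [lra|].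
  destruct (Hg (eps / 2)) as [d2 [Hd2 H2]]; [lra|].
  exists (Rmin d1 d2). split; [now apply Rmin_pos|]. intros y Hy Hyx.
  pose proof (Rmin_l d1 d2). pose proof (Rmin_r d1 d2).
  specialize (H1 y Hy ltac:(lra)). specialize (H2 y Hy ltac:(lra)).
  replace (f y + g y - (f x + g x) - RtoC (y - x) * (lf + lg))%C
    with ((f y - f x - RtoC (y - x) * lf) + (g y - g x - RtoC (y - x) * lg))%C by ring.
  eapply Rle_trans; [apply Cmod_triangle|]. lra.
Qed.

Lemma is_derive_ge_cmult (X : R) (c : C) (f : R -> C) (x : R) (l : C) : X <= x ->
  is_derive_ge X f x l -> is_derive_ge X (fun y => c * f y)%C x (c * l)%C.
Proof.
  intros Hx Hf. apply is_derive_ge_iff; [exact Hx|].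
  rewrite is_derive_ge_iff in Hf by exact Hx. intros eps He.
  pose proof (Cmod_ge_0 c) as Hc.
  destruct (Hf (eps / (Cmod c + 1))) as [d [Hd H]]; [apply Rdiv_lt_0_compat; lra|].
  exists d. split; [exact Hd|]. intros y Hy Hyx. specialize (H y Hy Hyx).
  replace (c * f y - c * f x - RtoC (y - x) * (c * l))%C
    with (c * (f y - f x - RtoC (y - x) * l))%C by ring.
  rewrite Cmod_mult.
  eapply Rle_trans; [apply Rmult_le_compat_l; [exact Hc | exact H]|].
  pose proof (Rabs_pos (y - x)).
  replace (Cmod c * (eps / (Cmod c + 1) * Rabs (y - x)))
    with (Cmod c / (Cmod c + 1) * (eps * Rabs (y - x))) by (field; lra).
  rewrite <- (Rmult_1_l (eps * Rabs (y - x))) at 2.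
  apply Rmult_le_compat_r; [nra|].
  apply (Rmult_le_reg_r (Cmod c + 1)); [lra|]. field_simplify; lra.
Qed.

Lemma is_derive_ge_const (X : R) (c : C) (x : R) : X <= x ->
  is_derive_ge X (fun _ => c) x (RtoC 0).
Proof.
  intros Hx. apply is_derive_ge_iff; [exact Hx|]. intros eps He. exists 1.
  split; [lra|]. intros y _ _. replace (_ - _ - _)%C with (RtoC 0) by ring.
  rewrite Cmod_0. pose proof (Rabs_pos (y - x)). nra.
Qed.

Lemma is_derive_ge_linear (X : R) (c : C) (x : R) : X <= x ->
  is_derive_ge X (fun y => RtoC y * c)%C x c.
Proof.
  intros Hx. apply is_derive_ge_iff; [exact Hx|]. intros eps He. exists 1.
  split; [lra|]. intros y _ _. replace (_ - _ - _)%C with (RtoC 0).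
  - rewrite Cmod_0. pose proof (Rabs_pos (y - x)). nra.
  - rewrite RtoC_minus. ring.
Qed.

(** Points [x + e] to the right stay in the half-line, so difference quotients there determine the
    derivative even at [X]. *)
Lemma is_derive_ge_unique (X : R) (f : R -> C) (x : R) (l1 l2 : C) : X <= x ->
  is_derive_ge X f x l1 -> is_derive_ge X f x l2 -> l1 = l2.
Proof.
  intros Hx H1 H2. rewrite is_derive_ge_iff in H1, H2 by exact Hx.
  destruct (Req_dec (Cmod (l1 - l2)) 0) as [E | E].
  { apply Cmod_eq_0 in E. replace l1 with ((l1 - l2) + l2)%C by ring. rewrite E. ring. }
  exfalso. pose proof (Cmod_ge_0 (l1 - l2)) as Hp.
  destruct (H1 (Cmod (l1 - l2) / 4)) as [d1 [Hd1 K1]]; [lra|].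
  destruct (H2 (Cmod (l1 - l2) / 4)) as [d2 [Hd2 K2]]; [lra|].
  pose proof (Rmin_l d1 d2). pose proof (Rmin_r d1 d2).
  assert (Hm : 0 < Rmin d1 d2) by now apply Rmin_pos.
  set (e := Rmin d1 d2 / 2) in *.
  assert (Hee : Rabs (x + e - x) = e).
  { replace (x + e - x) with e by ring. apply Rabs_pos_eq. unfold e. lra. }
  specialize (K1 (x + e)). specialize (K2 (x + e)). rewrite Hee in K1, K2.
  specialize (K1 ltac:(unfold e; lra) ltac:(unfold e; lra)).
  specialize (K2 ltac:(unfold e; lra) ltac:(unfold e; lra)).
  assert (K : Cmod (RtoC (x + e - x) * (l1 - l2)) <= Cmod (l1 - l2) / 2 * e).
  { replace (RtoC (x + e - x) * (l1 - l2))%C with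
      ((f (x + e)%R - f x - RtoC (x + e - x) * l2)
        + - (f (x + e)%R - f x - RtoC (x + e - x) * l1))%C by ring.
    eapply Rle_trans; [apply Cmod_triangle|]. rewrite Cmod_opp. lra. }
  rewrite Cmod_mult, Cmod_R, Hee in K. assert (0 < e) by (unfold e; lra). nra.
Qed.

Lemma is_derive_ge_of_components (X : R) (f : R -> C) (x : R) (l : C) : X <= x ->
  is_derive (fun y => Re (f y)) x (Re l) -> is_derive (fun y => Im (f y)) x (Im l) ->
  is_derive_ge X f x l.
Proof.
  intros Hx H1 H2. apply is_derive_ge_iff; [exact Hx|]. intros eps He.
  destruct H1 as [_ H1]. destruct H2 as [_ H2].
  assert (He2 : 0 < eps / 2) by lra.
  destruct (H1 x (fun P HP => HP) (mkposreal _ He2)) as [d1 K1].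
  destruct (H2 x (fun P HP => HP) (mkposreal _ He2)) as [d2 K2].
  exists (Rmin d1 d2). split; [apply Rmin_pos; apply cond_pos|]. intros y _ Hyx.
  pose proof (Rmin_l d1 d2). pose proof (Rmin_r d1 d2).
  assert (L1 := K1 y ltac:(change (Rabs (y - x) < d1); lra)).
  assert (L2 := K2 y ltac:(change (Rabs (y - x) < d2); lra)).
  change (Rabs (Re (f y) - Re (f x) - (y - x) * Re l) <= eps / 2 * Rabs (y - x)) in L1.
  change (Rabs (Im (f y) - Im (f x) - (y - x) * Im l) <= eps / 2 * Rabs (y - x)) in L2.
  set (u := Re (f y) - Re (f x) - (y - x) * Re l) in *.
  set (v := Im (f y) - Im (f x) - (y - x) * Im l) in *.
  replace (f y - f x - RtoC (y - x) * l)%C with (RtoC u + Ci * RtoC v)%C.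
  2:{ apply C_ext; unfold u, v; destruct (f y), (f x), l; cbn; ring. }
  eapply Rle_trans; [apply Cmod_triangle|].
  rewrite Cmod_mult, Cmod_Ci, !Cmod_R. lra.
Qed.

(* Continuing [f] linearly to the left of [X] turns one-sided derivatives
   into ordinary ones. *)
Definition lin_ext (X : R) (f : R -> C) (l : C) (y : R) : C :=
  if Rle_dec X y then f y else (f X + RtoC (y - X) * l)%C.

(** The slope is frozen at [df X] on the left, hence [Rmax X x]. Real and imaginary parts are
    separated for the real mean value theorem. *)
Lemma is_derive_ge_lin_ext (X : R) (f df : R -> C) :
  (forall x, X <= x -> is_derive_ge X f x (df x)) ->
  forall x,
    is_derive (fun y => Re (lin_ext X f (df X) y)) x (Re (df (Rmax X x))) /\
    is_derive (fun y => Im (lin_ext X f (df X) y)) x (Im (df (Rmax X x))).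
Proof.
  intros H x.
  assert (K : forall eps, 0 < eps -> exists d, 0 < d /\ forall y, Rabs (y - x) < d ->
     Cmod (lin_ext X f (df X) y - lin_ext X f (df X) x - RtoC (y - x) * df (Rmax X x))%C
      <= eps * Rabs (y - x)).
  { intros eps He. destruct (Rle_dec X x) as [Hx | Hx].
    - rewrite Rmax_right by exact Hx.
      pose proof (H x Hx) as Hd. rewrite is_derive_ge_iff in Hd by exact Hx.
      destruct (Hd eps He) as [d [Hd1 Hd2]].
      destruct (Req_dec X x) as [E | E].
      + exists d. split; [exact Hd1|]. intros y Hy. unfold lin_ext.
        destruct (Rle_dec X x); [|contradiction]. destruct (Rle_dec X y) as [Hy' | Hy'].
        * now apply Hd2.
        * rewrite <- E. replace (_ - _ - _)%C with (RtoC 0) by ring.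
          rewrite Cmod_0. pose proof (Rabs_pos (y - X)). nra.
      + exists (Rmin d (x - X)). split; [apply Rmin_pos; lra|]. intros y Hy.
        pose proof (Rmin_l d (x - X)). pose proof (Rmin_r d (x - X)).
        unfold lin_ext. destruct (Rle_dec X x); [|contradiction].
        destruct (Rle_dec X y) as [Hy' | Hy'].
        * apply Hd2; lra.
        * exfalso. rewrite Rabs_minus_sym in Hy. pose proof (Rle_abs (x - y)). lra.
    - rewrite Rmax_left by lra. exists (X - x). split; [lra|]. intros y Hy.
      unfold lin_ext. destruct (Rle_dec X x); [contradiction|].
      destruct (Rle_dec X y) as [Hy' | Hy'].
      + exfalso. pose proof (Rle_abs (y - x)). lra.
      + replace (_ - _ - _)%C with (RtoC 0).
        * rewrite Cmod_0. pose proof (Rabs_pos (y - x)). nra.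
        * rewrite !RtoC_minus. ring. }
  split; (split; [apply is_linear_scal_l|]);
    intros x' Hx'; apply (is_filter_lim_locally_unique (V := R_NormedModule)) in Hx'; subst x';
    intros eps; destruct (K eps (cond_pos eps)) as [d [Hd1 Hd2]];
    exists (mkposreal d Hd1); intros y Hy; specialize (Hd2 y Hy);
    eapply Rle_trans; [| exact Hd2 | | exact Hd2].
  - eapply Rle_trans; [|apply re_le_Cmod]. right.
    unfold norm, minus, plus, opp, scal; cbn -[lin_ext]. unfold abs, mult; cbn -[lin_ext].
    f_equal. unfold Re, Im, Rminus. ring.
  - eapply Rle_trans; [|eapply Rle_trans; [apply Rmax_r | apply Rmax_Cmod]]. right.
    unfold norm, minus, plus, opp, scal; cbn -[lin_ext]. unfold abs, mult; cbn -[lin_ext].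
    f_equal. unfold Re, Im, Rminus. ring.
Qed.

Lemma is_derive_ge_mono (X X' : R) (f : R -> C) (x : R) (l : C) : X <= X' <= x ->
  is_derive_ge X f x l -> is_derive_ge X' f x l.
Proof.
  intros HX H. apply is_derive_ge_iff; [lra|].
  rewrite is_derive_ge_iff in H by lra. intros eps He.
  destruct (H eps He) as [d [Hd K]]. exists d. split; [exact Hd|].
  intros y Hy. apply K. lra.
Qed.

(** The mean value theorem gives different intermediate points for the two parts; adding both
    estimates costs the factor 2. *)
Lemma is_derive_ge_variation (X : R) (f df : R -> C) (M y : R) : X <= y ->
  (forall x, X <= x -> is_derive_ge X f x (df x)) ->
  (forall x, X <= x <= y -> Cmod (df x) <= M) ->
  Cmod (f y - f X) <= 2 * M * (y - X).
Proof.
  intros Hy H HM.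
  pose proof (is_derive_ge_lin_ext X f df H) as K.
  assert (L : forall z, X <= z -> lin_ext X f (df X) z = f z).
  { intros z Hz. unfold lin_ext. destruct (Rle_dec X z); [reflexivity | lra]. }
  destruct (MVT_gen (fun y => Re (lin_ext X f (df X) y)) X y
    (fun x => Re (df (Rmax X x)))) as [c1 [Hc1 E1]].
  { intros x _. apply K. }
  { intros x _. apply continuity_pt_filterlim.
    apply (ex_derive_continuous (V := R_NormedModule)). eexists. apply K. }
  destruct (MVT_gen (fun y => Im (lin_ext X f (df X) y)) X y
    (fun x => Im (df (Rmax X x)))) as [c2 [Hc2 E2]].
  { intros x _. apply K. }
  { intros x _. apply continuity_pt_filterlim.
    apply (ex_derive_continuous (V := R_NormedModule)). eexists. apply K. }
  rewrite Rmin_left, Rmax_right in Hc1, Hc2 by lra.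
  rewrite !L in E1, E2 by lra. rewrite Rmax_right in E1, E2 by lra.
  replace (f y - f X)%C with (RtoC (Re (df c1) * (y - X)) + Ci * RtoC (Im (df c2) * (y - X)))%C.
  2:{ rewrite <- E1, <- E2. apply C_ext; destruct (f y), (f X); cbn; ring. }
  eapply Rle_trans; [apply Cmod_triangle|].
  rewrite Cmod_mult, Cmod_Ci, !Cmod_R, !Rabs_mult, (Rabs_pos_eq (y - X)) by lra.
  pose proof (re_le_Cmod (df c1)). pose proof (HM c1 Hc1). pose proof (HM c2 Hc2).
  pose proof (Rmax_Cmod (df c2)). pose proof (Rmax_r (Rabs (fst (df c2))) (Rabs (snd (df c2)))).
  change (snd (df c2)) with (Im (df c2)) in *. nra.
Qed.

(** * Discrete convolution *)

(** The Cauchy product of power series. The recursion shifts the left factor, so inductions on [m]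
    generalise over [u]. *)
Fixpoint conv (u v : nat -> C) (m : nat) : C :=
  match m with
  | O => u O * v O
  | S k => u O * v (S k) + conv (fun l => u (S l)) v k
  end%C.

Lemma conv_ext (u u' v v' : nat -> C) (m : nat) :
  (forall l, (l <= m)%nat -> u l = u' l) -> (forall l, (l <= m)%nat -> v l = v' l) ->
  conv u v m = conv u' v' m.
Proof.
  revert u u'. induction m as [|m IH]; intros u u' Hu Hv; cbn.
  - now rewrite Hu, Hv by lia.
  - rewrite Hu, Hv by lia. f_equal. apply IH; intros l Hl; [apply Hu | apply Hv]; lia.
Qed.

Lemma conv_sum_n (u v : nat -> C) (m : nat) :
  sum_n (fun l => u l * v (m - l)%nat)%C m = conv u v m.
Proof.
  revert u. induction m as [|m IH]; intros u.
  - now rewrite sum_O.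
  - cbn [conv]. rewrite <- IH. unfold sum_n at 1. rewrite sum_Sn_m by lia.
    rewrite <- sum_n_m_S. reflexivity.
Qed.

Lemma conv_plus_l (u u' v : nat -> C) (m : nat) :
  conv (fun l => u l + u' l)%C v m = (conv u v m + conv u' v m)%C.
Proof.
  revert u u'. induction m as [|m IH]; intros u u'; cbn; [ring|].
  rewrite (IH (fun l => u (S l)) (fun l => u' (S l))). ring.
Qed.

Lemma conv_scal_l (c : C) (u v : nat -> C) (m : nat) :
  conv (fun l => c * u l)%C v m = (c * conv u v m)%C.
Proof.
  revert u. induction m as [|m IH]; intros u; cbn; [ring|].
  rewrite (IH (fun l => u (S l))). ring.
Qed.

Lemma conv_S_r (u v : nat -> C) (m : nat) :
  conv u v (S m) = (u (S m) * v O + conv u (fun l => v (S l)) m)%C.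
Proof.
  revert u. induction m as [|m IH]; intros u; [cbn; ring|].
  change (conv u v (S (S m))) with (u O * v (S (S m)) + conv (fun l => u (S l)) v (S m))%C.
  rewrite IH. cbn [conv]. ring.
Qed.

Lemma conv_comm (u v : nat -> C) (m : nat) : conv u v m = conv v u m.
Proof.
  revert u. induction m as [|m IH]; intros u; [cbn; ring|].
  rewrite (conv_S_r v u). cbn [conv]. rewrite IH. ring.
Qed.

Lemma conv_assoc (u v w : nat -> C) (m : nat) :
  conv u (conv v w) m = conv (conv u v) w m.
Proof.
  revert u. induction m as [|m IH]; intros u; [cbn; ring|].
  change (conv u (conv v w) (S m))
    with (u O * conv v w (S m) + conv (fun l => u (S l)) (conv v w) m)%C.
  rewrite IH.
  change (conv (conv u v) w (S m)) with
    (u O * v O * w (S m)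
     + conv (fun k => u O * v (S k) + conv (fun l => u (S l)) v k)%C w m)%C.
  rewrite (conv_plus_l (fun k => u O * v (S k))%C).
  rewrite (conv_scal_l _ (fun k => v (S k))). cbn [conv]. ring.
Qed.

(** The product rule for [z d/dz], which multiplies the coefficient of index l by l. *)
Lemma conv_leibniz (u v : nat -> C) (m : nat) :
  (conv (fun l => RtoC (INR l) * u l)%C v m + conv u (fun l => RtoC (INR l) * v l)%C m
   = RtoC (INR m) * conv u v m)%C.
Proof.
  revert u. induction m as [|m IH]; intros u; [cbn; ring|].
  assert (E : conv (fun l => RtoC (INR (S l)) * u (S l))%C v m
    = (conv (fun l => RtoC (INR l) * u (S l)) v m + conv (fun l => u (S l)) v m)%C).
  { rewrite <- conv_plus_l. apply conv_ext; intros l _; [|reflexivity].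
    rewrite S_INR, RtoC_plus. ring. }
  cbn [conv]. rewrite E. pose proof (IH (fun l => u (S l))) as I. cbn beta in I.
  rewrite Cplus_assoc.
  replace (conv (fun l => RtoC (INR l) * u (S l))%C v m) with
    (RtoC (INR m) * conv (fun l => u (S l)) v m
     - conv (fun l => u (S l)) (fun l => RtoC (INR l) * v l)%C m)%C by (rewrite <- I; ring).
  rewrite S_INR, RtoC_plus. cbn [INR]. ring.
Qed.

(** * Legendre polynomials *)

Lemma Legendre_SS (n : nat) (x : R) :
  Legendre (S (S n)) x =
  ((2 * INR n + 3) * x * Legendre (S n) x - (INR n + 1) * Legendre n x) / (INR n + 2).
Proof. reflexivity. Qed.

(** The classical relation P'_(n+1) = x P'_n + (n + 1) P_n, taken as the definition of the
    derivatives. *)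
Fixpoint dLegendre (n : nat) (x : R) : R :=
  match n with
  | O => 0
  | S k => x * dLegendre k x + INR n * Legendre k x
  end.

(** Needed to differentiate Bonnet's recursion: it eliminates P'_n in favour of P'_(n+1) and
    P_(n+1). *)
Lemma dLegendre_prev (n : nat) (x : R) :
  x * dLegendre (S n) x - dLegendre n x = INR (S n) * Legendre (S n) x.
Proof.
  induction n as [|n IH]; [cbn; ring|].
  change (dLegendre (S (S n)) x)
    with (x * dLegendre (S n) x + INR (S (S n)) * Legendre (S n) x).
  pose proof (pos_INR n).
  replace (x * dLegendre (S n) x)
    with (dLegendre n x + INR (S n) * Legendre (S n) x) by lra.
  change (dLegendre (S n) x) with (x * dLegendre n x + INR (S n) * Legendre n x).
  rewrite (Legendre_SS n x), !S_INR. field. lra.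
Qed.

Lemma is_derive_Legendre (n : nat) (x : R) :
  is_derive (Legendre n) x (dLegendre n x).
Proof.
  cut (is_derive (Legendre n) x (dLegendre n x) /\
       is_derive (Legendre (S n)) x (dLegendre (S n) x)); [tauto|].
  induction n as [|n [IH1 IH2]].
  - split; cbn.
    + apply (is_derive_const (K := R_AbsRing) (V := R_NormedModule)).
    + evar_last; [apply (is_derive_id (K := R_AbsRing))|].
      unfold one; cbn. ring.
  - split; [exact IH2|].
    pose proof (pos_INR n).
    apply (is_derive_ext (fun x => ((2 * INR n + 3) / (INR n + 2)) * (x * Legendre (S n) x)
       - ((INR n + 1) / (INR n + 2)) * Legendre n x)).
    { intros t. rewrite (Legendre_SS n t).
      match goal with |- ?l = ?r => change (@eq R l r) end. field. lra. }
    evar_last.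
    { apply (is_derive_minus (V := R_NormedModule)).
      - apply is_derive_scal. apply (is_derive_mult (K := R_AbsRing)
         (fun x => x) (Legendre (S n))).
        + apply (is_derive_id (K := R_AbsRing)).
        + exact IH2.
        + intros. apply Rmult_comm.
      - apply is_derive_scal. exact IH1. }
    unfold minus, plus, opp, mult, one, scal; cbn -[dLegendre INR Legendre].
    unfold mult; cbn -[dLegendre INR Legendre].
    pose proof (dLegendre_prev n x) as P.
    change (dLegendre (S (S n)) x)
      with (x * dLegendre (S n) x + INR (S (S n)) * Legendre (S n) x).
    rewrite !S_INR in *.
    replace (dLegendre n x) with (x * dLegendre (S n) x - (INR n + 1) * Legendre (S n) x) by lra.
    field. lra.
Qed.

(** The factor 2 n + 3 is the denominator of [leg_coef x (S (S n))] and cancels when that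
    coefficient is differentiated. *)
Lemma dLegendre_diff (n : nat) (x : R) :
  dLegendre (S (S n)) x - dLegendre n x = (2 * INR n + 3) * Legendre (S n) x.
Proof.
  pose proof (dLegendre_prev n x) as P.
  change (dLegendre (S (S n)) x)
    with (x * dLegendre (S n) x + INR (S (S n)) * Legendre (S n) x).
  rewrite !S_INR in *. lra.
Qed.

(* [P_{n+1}^2 - 2 x P_{n+1} P_n + P_n^2] decreases in [n], since
   [P_{n+2} - x P_{n+1} = (n + 1) / (n + 2) (x P_{n+1} - P_n)]. *)
Lemma Legendre_turan (n : nat) (x : R) :
  (x * Legendre (S n) x - Legendre n x) ^ 2 + (1 - x ^ 2) * Legendre (S n) x ^ 2
  <= 1 - x ^ 2.
Proof.
  induction n as [|n IH]; [cbn; nra|].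
  pose proof (pos_INR n).
  set (p := Legendre (S n) x) in *. set (q := Legendre n x) in *.
  set (r := (INR n + 1) / (INR n + 2)).
  assert (Hr : 0 <= r <= 1).
  { unfold r. split; [apply Rdiv_le_0_compat; lra|].
    apply (Rmult_le_reg_r (INR n + 2)); [lra|]. unfold Rdiv.
    rewrite Rmult_assoc, Rinv_l; lra. }
  assert (E : Legendre (S (S n)) x = x * p + r * (x * p - q)).
  { rewrite (Legendre_SS n x). fold p q. unfold r. field. lra. }
  rewrite E. set (d := x * p - q) in *.
  replace ((x * (x * p + r * d) - p) ^ 2 + (1 - x ^ 2) * (x * p + r * d) ^ 2)
    with (r ^ 2 * d ^ 2 + (1 - x ^ 2) * p ^ 2) by ring.
  assert (r ^ 2 <= 1) by nra. pose proof (pow2_ge_0 d). nra.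
Qed.

Lemma Legendre_bound (n : nat) (x : R) : Rabs x <= 1 -> Rabs (Legendre n x) <= 1.
Proof.
  intros Hx.
  assert (Hx2 : x ^ 2 <= 1).
  { rewrite <- (pow2_abs x). pose proof (Rabs_pos x). nra. }
  destruct n as [|n]; [cbn; rewrite Rabs_R1; lra|].
  (* Away from the endpoints [1 - x ^ 2] can be cancelled in [Legendre_turan]. At x = 1 or -1 that
     inequality forces x P_(k+1) = P_k, hence P_(k+1) = x P_k. *)
  destruct (Req_dec (x ^ 2) 1) as [E | E].
  - assert (T : forall k, Legendre (S k) x = x * Legendre k x).
    { intros k. pose proof (Legendre_turan k x) as T. rewrite E in T.
      assert (F : x * Legendre (S k) x = Legendre k x) by nra.
      rewrite <- F. rewrite <- Rmult_assoc. replace (x * x) with (x ^ 2) by ring.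
      rewrite E. ring. }
    induction n as [|n IH]; [cbn; exact Hx|].
    rewrite T, Rabs_mult. pose proof (Rabs_pos (Legendre (S n) x)).
    pose proof (Rabs_pos x). nra.
  - pose proof (Legendre_turan n x) as T.
    pose proof (pow2_ge_0 (x * Legendre (S n) x - Legendre n x)).
    rewrite <- Rabs_R1. apply Rsqr_le_abs_0. unfold Rsqr. nra.
Qed.

(** * The kernel as a square root *)

Lemma RtoC_neq0 (x : R) : x <> 0 -> RtoC x <> RtoC 0.
Proof. intros H E. apply H. now apply RtoC_inj. Qed.

(** The Taylor coefficients in z of sqrt (1 - 2 x z + z^2): the real factor of [Rker], without the
    power of [kappa]. *)
Definition leg_coef (x : R) (m : nat) : R :=
  - (LegendreZ (Z.of_nat m) x - LegendreZ (Z.of_nat m - 2) x) / (2 * INR m - 1).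

Lemma leg_coef_0 (x : R) : leg_coef x 0 = 1.
Proof. unfold leg_coef, LegendreZ; cbn. field. Qed.

Lemma leg_coef_1 (x : R) : leg_coef x 1 = - x.
Proof. unfold leg_coef, LegendreZ. rewrite Nat2Z.id. cbn. field. Qed.

Lemma leg_coef_SS (n : nat) (x : R) :
  leg_coef x (S (S n)) = - (Legendre (S (S n)) x - Legendre n x) / (2 * INR n + 3).
Proof.
  unfold leg_coef, LegendreZ.
  destruct (Z.ltb_spec (Z.of_nat (S (S n))) 0) as [H | _]; [lia|].
  destruct (Z.ltb_spec (Z.of_nat (S (S n)) - 2) 0) as [H | _]; [lia|].
  rewrite Nat2Z.id. replace (Z.to_nat (Z.of_nat (S (S n)) - 2)) with n by lia.
  f_equal. rewrite !S_INR. ring.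
Qed.

Lemma odd_neq0 (m : nat) : 2 * INR m - 1 <> 0.
Proof.
  destruct m as [|m]; [cbn; lra|]. rewrite S_INR. pose proof (pos_INR m). lra.
Qed.

Lemma Rker_leg_coef (kappa : C) (x : R) (m : nat) :
  Rker kappa x m = (kappa ^ m * RtoC (leg_coef x m))%C.
Proof.
  unfold Rker, leg_coef. pose proof (odd_neq0 m) as H.
  set (p := LegendreZ _ x - LegendreZ _ x).
  rewrite RtoC_div, RtoC_opp by exact H. field. now apply RtoC_neq0.
Qed.

(** Coefficient of z^(n+1) in (1 - 2 x z + z^2) R' = (z - x) R. The values n = 0 and n = 1 are
    separate because [leg_coef_SS] starts at index 2. *)
Lemma leg_coef_rec (n : nat) (x : R) :
  (INR n + 2) * leg_coef x (S (S n))
  = (2 * INR n + 1) * x * leg_coef x (S n) - (INR n - 1) * leg_coef x n.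
Proof.
  destruct n as [|[|n]].
  - rewrite leg_coef_SS, leg_coef_1, leg_coef_0. cbn. field.
  - rewrite !leg_coef_SS, leg_coef_1. cbn. field.
  - rewrite !leg_coef_SS. pose proof (pos_INR n).
    rewrite (Legendre_SS (S (S n))), (Legendre_SS (S n)), (Legendre_SS n), !S_INR.
    field. repeat split; lra.
Qed.

(** Substituting q z for z is multiplicative; this is applied with q = varkappa. *)
Lemma conv_geom (q : C) (u v : nat -> C) (m : nat) :
  conv (fun l => q ^ l * u l)%C (fun l => q ^ l * v l)%C m = (q ^ m * conv u v m)%C.
Proof.
  revert u. induction m as [|m IH]; intros u; [cbn; ring|].
  cbn [conv].
  rewrite (conv_ext _ (fun l => q * (q ^ l * u (S l)))%C _ (fun l => q ^ l * v l)%C m).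
  - rewrite (conv_scal_l q (fun l => q ^ l * u (S l)))%C, (IH (fun l => u (S l))).
    cbn. ring.
  - intros l _. cbn. ring.
  - reflexivity.
Qed.

(* The generating function [R] of [leg_coef x] satisfies
   [(1 - 2 x z + z^2) R' = (z - x) R], whence the recurrence for [R^2]. *)
Lemma leg_coef_square_rec (x : R) (m : nat) :
  let r := fun l => RtoC (leg_coef x l) in
  (RtoC (INR m + 2) * conv r r (S (S m))
   = RtoC (2 * x * INR m) * conv r r (S m) - RtoC (INR m - 2) * conv r r m)%C.
Proof.
  intros r. set (D := fun l => (RtoC (INR l) * r l)%C).
  (* With D = z R', this is 2 D R = z (R^2)'. *)
  assert (Ht : forall k, (2 * conv D r k = RtoC (INR k) * conv r r k)%C).
  { intros k. rewrite <- conv_leibniz. fold D. rewrite (conv_comm r D). ring. }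
  assert (H1 : conv D r (S (S m)) = conv (fun l => D (S l)) r (S m)).
  { change (conv D r (S (S m)))
      with (D O * r (S (S m)) + conv (fun l => D (S l)) r (S m))%C.
    unfold D at 1. cbn [INR]. ring. }
  (* The differential equation solved for R' reads R' = 2 x D - x R - z (D - R); [sh] holds the
     coefficients of z (D - R), and [H2] is this equation multiplied by R. *)
  set (sh := fun l => match l with O => RtoC 0 | S k => D k + - (1) * r k end%C).
  assert (H2 : conv (fun l => D (S l)) r (S m)
    = (RtoC (2 * x) * conv D r (S m) + RtoC (- x) * conv r r (S m) + - (1) * conv sh r (S m))%C).
  { rewrite <- !conv_scal_l, <- !conv_plus_l. apply conv_ext; [|reflexivity].
    intros [|l] _.
    - unfold D, sh, r. rewrite leg_coef_1, leg_coef_0. cbn [INR].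
      rewrite RtoC_opp. ring.
    - unfold D, sh, r. pose proof (leg_coef_rec l x) as E.
      replace (INR (S (S l))) with (INR l + 2) by (rewrite !S_INR; ring).
      rewrite <- !RtoC_mult, E, S_INR. unfold D, r.
      rewrite <- !RtoC_opp, <- !RtoC_mult, <- !RtoC_plus, <- ?RtoC_mult, <- ?RtoC_plus.
      f_equal. ring. }
  assert (H3 : conv sh r (S m) = (conv D r m + - (1) * conv r r m)%C).
  { rewrite <- conv_scal_l, <- conv_plus_l.
    change (conv sh r (S m)) with (RtoC 0 * r (S m) + conv (fun l => sh (S l)) r m)%C.
    rewrite Cmult_0_l, Cplus_0_l. reflexivity. }
  pose proof (Ht (S (S m))) as E. rewrite H1, H2, H3 in E.
  replace (2 * (RtoC (2 * x) * conv D r (S m) + RtoC (- x) * conv r r (S m)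
    + - (1) * (conv D r m + - (1) * conv r r m)))%C
    with (RtoC (2 * x) * (2 * conv D r (S m)) + 2 * RtoC (- x) * conv r r (S m)
      + - (2 * conv D r m) + 2 * conv r r m)%C in E by ring.
  rewrite !Ht in E.
  replace (INR m + 2) with (INR (S (S m))) by (rewrite !S_INR; ring).
  rewrite <- E, !S_INR, !RtoC_minus, !RtoC_mult, !RtoC_opp, !RtoC_plus. ring.
Qed.

Lemma leg_coef_square (x : R) :
  let r := fun l => RtoC (leg_coef x l) in
  conv r r 0 = RtoC 1 /\ conv r r 1 = RtoC (- 2 * x) /\ conv r r 2 = RtoC 1 /\
  forall m, conv r r (S (S (S m))) = RtoC 0.
Proof.
  intros r. pose proof (leg_coef_square_rec x) as Hrec. cbv zeta in Hrec. fold r in Hrec.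
  assert (Hdiv : forall n (z w : C), (RtoC (INR n + 2) * z = RtoC (INR n + 2) * w)%C -> z = w).
  { intros n z w E. pose proof (pos_INR n).
    assert (N : RtoC (INR n + 2) <> 0) by (apply RtoC_neq0; lra).
    replace z with (/ RtoC (INR n + 2) * (RtoC (INR n + 2) * z))%C by (field; exact N).
    rewrite E. field; exact N. }
  assert (E0 : conv r r 0 = RtoC 1).
  { cbn. unfold r. rewrite leg_coef_0. ring. }
  assert (E1 : conv r r 1 = RtoC (- 2 * x)).
  { cbn. unfold r. rewrite leg_coef_0, leg_coef_1, RtoC_mult, !RtoC_opp. ring. }
  assert (E2 : conv r r 2 = RtoC 1).
  { apply (Hdiv O). rewrite (Hrec O), E0, E1. cbn [INR].
    rewrite <- !RtoC_mult, <- RtoC_minus. f_equal. ring. }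
  assert (E3 : conv r r 3 = RtoC 0).
  { apply (Hdiv 1%nat). rewrite (Hrec 1%nat), E2, E1. cbn [INR].
    rewrite <- !RtoC_mult, <- RtoC_minus. f_equal. ring. }
  (* The factor m - 2 of the recurrence vanishes at m = 2 and removes the nonzero coefficient of
     index 2. Two consecutive zeros then propagate. *)
  assert (E4 : conv r r 4 = RtoC 0).
  { apply (Hdiv 2%nat). rewrite (Hrec 2%nat), E3, E2.
    rewrite <- !RtoC_mult, <- RtoC_minus. f_equal. cbn [INR]. ring. }
  repeat split; [exact E0 | exact E1 | exact E2 |].
  intros m. enough (conv r r (S (S (S m))) = RtoC 0 /\ conv r r (S (S (S (S m)))) = RtoC 0) by tauto.
  induction m as [|m [I1 I2]]; [now split|].
  split; [exact I2|]. apply (Hdiv (S (S (S m)))).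
  rewrite (Hrec (S (S (S m)))), I1, I2. ring.
Qed.

(** * Unit complex numbers and the branch of the half-argument *)

Lemma cis_plus (s t : R) : (cis s * cis t)%C = cis (s + t).
Proof. unfold cis, Cmult; cbn. rewrite cos_plus, sin_plus. f_equal; ring. Qed.

Lemma cis_opp (t : R) : cis (- t) = Cconj (cis t).
Proof. unfold cis, Cconj; cbn. now rewrite cos_neg, sin_neg. Qed.

Lemma Cmod_cis (t : R) : Cmod (cis t) = 1.
Proof.
  unfold Cmod, cis; cbn. rewrite !Rmult_1_r.
  pose proof (sin2_cos2 t) as H. unfold Rsqr in H. rewrite Rplus_comm, H. apply sqrt_1.
Qed.

Lemma Cmod1_conj (z : C) : Cmod z = 1 -> (z * Cconj z = 1)%C.
Proof. intros H. rewrite <- Cmod2_conj, H. f_equal. ring. Qed.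

(** The square root of [z / Cmod z] in the closed upper half-plane. *)
Definition half_cis (z : C) : C := cis (arg0 z / 2).

Lemma Cmod_half_cis (z : C) : Cmod (half_cis z) = 1.
Proof. apply Cmod_cis. Qed.

Lemma half_cis_sqr (z : C) : z <> 0 -> (RtoC (Cmod z) * (half_cis z * half_cis z))%C = z.
Proof.
  intros Hz. unfold half_cis. rewrite cis_plus.
  replace (arg0 z / 2 + arg0 z / 2) with (arg0 z) by field.
  symmetry. now apply arg0_spec.
Qed.

Lemma half_cis_Im (z : C) : z <> 0 -> 0 <= Im (half_cis z).
Proof.
  intros Hz. destruct (proj1 (arg0_spec z Hz)).
  unfold half_cis, cis; cbn. apply sin_ge_0; lra.
Qed.

(** On the closed upper half-plane [arg0] is an [acos], at most PI, so its half lies in the first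
    quadrant. *)
Lemma half_cis_Re (z : C) : 0 <= Im z -> 0 <= Re (half_cis z).
Proof.
  intros Hz. unfold half_cis, cis, arg0; cbn -[Rle_dec].
  destruct (Rle_dec 0 (Im z)) as [_ | H]; [|contradiction].
  pose proof (acos_bound (Re z / Cmod z)). apply cos_ge_0; lra.
Qed.

(** Two square roots of the same number are equal or opposite; the strict sign of [Im s] excludes
    the second case. *)
Lemma half_cis_unique (z s : C) : z <> 0 ->
  (RtoC (Cmod z) * (s * s))%C = z -> 0 < Im s -> half_cis z = s.
Proof.
  intros Hz Hs Hi. pose proof (half_cis_sqr z Hz) as E.
  pose proof (half_cis_Im z Hz) as Hi'. set (t := half_cis z) in *.
  assert (N : RtoC (Cmod z) <> 0) by (apply RtoC_neq0; apply Cmod_gt_0 in Hz; lra).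
  assert (P : ((t - s) * (t + s) = 0)%C).
  { replace ((t - s) * (t + s))%C
      with (/ RtoC (Cmod z) * (RtoC (Cmod z) * (t * t) - RtoC (Cmod z) * (s * s)))%C
      by (field; exact N).
    rewrite E, Hs. ring. }
  destruct (Ceq_dec (t - s) 0) as [D | D].
  - replace t with ((t - s) + s)%C by ring. rewrite D. ring.
  - exfalso. assert (Q : (t + s)%C = 0).
    { replace (t + s)%C with (/ (t - s) * ((t - s) * (t + s)))%C by (field; exact D).
      rewrite P. ring. }
    apply (f_equal Im) in Q. destruct t, s; cbn in *. lra.
Qed.

Lemma c0_half_cis (theta h : R) (a : C) :
  c0 theta h a = (RtoC (- (sqrt (Cmod (alpha_hat theta h a)) / 2))
                  * Cconj (half_cis (alpha_hat theta h a)))%C.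
Proof. unfold c0, half_cis. now rewrite cis_opp. Qed.

Lemma varkappa_half_cis (theta h : R) (a : C) :
  let s := half_cis (alpha_hat theta h a) in varkappa theta h a = (- (s * s))%C.
Proof.
  cbv zeta. unfold varkappa, half_cis. rewrite cis_plus. do 2 f_equal. field.
Qed.

(** The kernel of the discrete boundary condition for [theta = 1 / 4], which does not
    depend on the mesh size [h]; it is also the semi-discrete kernel. *)
Definition sd_conv_kernel (a : C) (m : nat) : C :=
  (c0 (1 / 4) 1 a * Rker (varkappa (1 / 4) 1 a) (mu (1 / 4) 1 a) m)%C.

Lemma alpha_hat_quarter (h : R) (a : C) : alpha_hat (1 / 4) h a = (2 * a)%C.
Proof.
  unfold alpha_hat. replace ((1 - 4 * (1 / 4)) * h ^ 2) with 0 by field. ring.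
Qed.

Lemma mu_quarter (h : R) (a : C) : a <> 0 -> mu (1 / 4) h a = Re a / Cmod a.
Proof.
  intros Ha. unfold mu, beta_hat. rewrite alpha_hat_quarter, Cmod_mult, Cmod_R, Rabs_pos_eq by lra.
  replace ((1 - 4 * (1 / 4)) * h ^ 2) with 0 by field.
  apply Cmod_gt_0 in Ha. field. lra.
Qed.

(** With s the half-direction of 2 a one has c0^2 = Cconj a / 2, varkappa = - s^2 and |a| s^2 = a.
    Then c0^2 (1 - 2 mu varkappa z + varkappa^2 z^2) has the coefficients listed, since Cconj a s^2
    = |a| and mu |a| = Re a. *)
Lemma sd_conv_kernel_square (a : C) : a <> 0 ->
  let g := sd_conv_kernel a in
  conv g g 0 = (Cconj a / 2)%C /\ conv g g 1 = RtoC (Re a) /\ conv g g 2 = (a / 2)%C /\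
  forall m, conv g g (S (S (S m))) = RtoC 0.
Proof.
  intros Ha g.
  assert (Ha2 : (2 * a)%C <> 0).
  { intros E. apply Ha. replace a with (/ 2 * (2 * a))%C by (field; apply RtoC_neq0; lra).
    rewrite E. ring. }
  assert (Hm : 0 < Cmod a) by now apply Cmod_gt_0.
  assert (Hm' : RtoC (Cmod a) <> 0) by (apply RtoC_neq0; lra).
  set (s := half_cis (2 * a)).
  set (x := Re a / Cmod a).
  set (r := fun l => RtoC (leg_coef x l)).
  assert (Hs : (RtoC (Cmod a) * (s * s))%C = a).
  { pose proof (half_cis_sqr _ Ha2) as E. fold s in E.
    rewrite Cmod_mult, Cmod_R, Rabs_pos_eq in E by lra. rewrite RtoC_mult in E.
    replace (RtoC (Cmod a) * (s * s))%C with (/ 2 * (2 * RtoC (Cmod a) * (s * s)))%C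
      by (field; apply RtoC_neq0; lra).
    rewrite E. field. }
  assert (Hs1 : (s * Cconj s = 1)%C) by (apply Cmod1_conj, Cmod_half_cis).
  assert (Hsc : (RtoC (Cmod a) * (Cconj s * Cconj s))%C = Cconj a).
  { rewrite <- Hs at 2. rewrite !Cmult_conj. f_equal.
    apply C_ext; cbn; ring. }
  assert (Hg : forall m, conv g g m = (Cconj a / 2 * ((- (s * s)) ^ m * conv r r m))%C).
  { intros m.
    rewrite (conv_ext g (fun l => c0 (1 / 4) 1 a * ((- (s * s)) ^ l * r l))%C
       g (fun l => c0 (1 / 4) 1 a * ((- (s * s)) ^ l * r l))%C m).
    - rewrite conv_scal_l, conv_comm, conv_scal_l, conv_geom.
      rewrite c0_half_cis, alpha_hat_quarter. fold s. rewrite <- Hsc.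
      rewrite Cmod_mult, Cmod_R, Rabs_pos_eq by lra.
      set (q := sqrt (2 * Cmod a)).
      assert (Hq : (RtoC q * RtoC q = 2 * RtoC (Cmod a))%C).
      { rewrite <- !RtoC_mult. f_equal. apply sqrt_sqrt. lra. }
      set (z := (_ * conv r r m)%C).
      replace (RtoC (- (q / 2))) with (- RtoC q / 2)%C
        by (rewrite RtoC_opp, RtoC_div; [field; apply RtoC_neq0|]; lra).
      replace (- RtoC q / 2 * Cconj s * (- RtoC q / 2 * Cconj s * z))%C
        with (RtoC q * RtoC q / 4 * (Cconj s * Cconj s) * z)%C
        by (field; repeat split; apply RtoC_neq0; lra).
      rewrite Hq. field; repeat split; apply RtoC_neq0; lra.
    - intros l _. unfold g, sd_conv_kernel.
      rewrite Rker_leg_coef, varkappa_half_cis, alpha_hat_quarter, mu_quarter by exact Ha.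
      reflexivity.
    - intros l _. unfold g, sd_conv_kernel.
      rewrite Rker_leg_coef, varkappa_half_cis, alpha_hat_quarter, mu_quarter by exact Ha.
      reflexivity. }
  destruct (leg_coef_square x) as [E0 [E1 [E2 E3]]]. fold r in E0, E1, E2, E3.
  assert (Hca : (Cconj a * (s * s) = RtoC (Cmod a))%C).
  { rewrite <- Hsc. replace (RtoC (Cmod a) * (Cconj s * Cconj s) * (s * s))%C
      with (RtoC (Cmod a) * ((s * Cconj s) * (s * Cconj s)))%C by ring. rewrite Hs1. ring. }
  rewrite !Hg, E0, E1, E2. repeat split.
  - cbn. field; apply RtoC_neq0; lra.
  - replace (Cconj a / 2 * ((- (s * s)) ^ 1 * RtoC (- 2 * x)))%C
      with ((Cconj a * (s * s)) * (RtoC (- 2 * x)) / (-2))%C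
      by (cbn; field; split; apply RtoC_neq0; lra).
    rewrite Hca, <- RtoC_mult, <- RtoC_div by lra. f_equal. unfold x. field. lra.
  - replace (Cconj a / 2 * ((- (s * s)) ^ 2 * 1))%C
      with ((Cconj a * (s * s)) * (s * s) / 2)%C by (cbn; field; apply RtoC_neq0; lra).
    now rewrite Hca, Hs.
  - intros m. rewrite Hg, E3. ring.
Qed.

(** * The transparent condition for decaying solutions *)

Lemma is_derive_ge_conv (X : R) (g : nat -> C) (F dF : nat -> R -> C) (x : R) (m : nat) :
  X <= x -> (forall k, (k <= m)%nat -> is_derive_ge X (F k) x (dF k x)) ->
  is_derive_ge X (fun y => conv g (fun k => F k y) m) x (conv g (fun k => dF k x) m).
Proof.
  intros Hx. revert g. induction m as [|m IH]; intros g H; cbn.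
  - now apply is_derive_ge_cmult; [|apply H].
  - apply is_derive_ge_plus; [exact Hx | |].
    + now apply is_derive_ge_cmult; [|apply H].
    + apply IH. intros k Hk. apply H. lia.
Qed.

Lemma conv_low_vanish (u v : nat -> C) (m : nat) :
  (forall j, (j < m)%nat -> v j = RtoC 0) -> conv u v m = (u O * v m)%C.
Proof.
  intros H. destruct m as [|m]; [reflexivity|]. cbn [conv].
  enough (E : forall u k, (k <= m)%nat -> conv u v k = RtoC 0) by (rewrite E by lia; ring).
  clear u. intros u k. revert u. induction k as [|k IH]; intros u Hk; cbn [conv].
  - rewrite H by lia. ring.
  - rewrite IH, H by lia. ring.
Qed.

(** [M] is uniform in [v], so it serves for all points x at once; the bound 2 is the one delivered
    by [filterlim_eventually_bounded]. *)
Lemma conv_bounded (g : nat -> C) (m : nat) : exists M, 0 <= M /\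
  forall v, (forall j, (j <= m)%nat -> Cmod (v j) <= 2) -> Cmod (conv g v m) <= M.
Proof.
  revert g. induction m as [|m IH]; intros g.
  - exists (Cmod (g O) * 2). pose proof (Cmod_ge_0 (g O)). split; [lra|].
    intros v Hv. cbn. rewrite Cmod_mult. apply Rmult_le_compat_l; [easy | now apply Hv].
  - destruct (IH (fun l => g (S l))) as [M [HM H]]. pose proof (Cmod_ge_0 (g O)).
    exists (Cmod (g O) * 2 + M). split; [lra|]. intros v Hv. cbn [conv].
    eapply Rle_trans; [apply Cmod_triangle|]. apply Rplus_le_compat.
    + rewrite Cmod_mult. apply Rmult_le_compat_l; [easy | apply Hv; lia].
    + apply H. intros j Hj. apply Hv. lia.
Qed.

(** N = |F|^2 satisfies N' = 2 Re lambda N, so N is nondecreasing and, by the mean value theorem,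
    grows at least linearly beyond any point where it is positive. This already contradicts
    boundedness. *)
Lemma growing_bounded_zero (X X0 M : R) (lambda : C) (F : R -> C) :
  0 < Re lambda -> (forall x, X <= x -> is_derive_ge X F x (lambda * F x)%C) ->
  (forall x, X0 <= x -> Cmod (F x) <= M) -> forall x, X <= x -> F x = RtoC 0.
Proof.
  intros Hl HF HM x1 Hx1. pose proof (is_derive_ge_lin_ext X F (fun x => lambda * F x)%C HF) as K.
  set (f := lin_ext X F (lambda * F X)%C) in K.
  assert (L : forall z, X <= z -> f z = F z).
  { intros z Hz. unfold f, lin_ext. destruct (Rle_dec X z); [reflexivity | lra]. }
  set (N := fun x => Re (f x) ^ 2 + Im (f x) ^ 2).
  assert (HN : forall x, X <= x -> is_derive N x (2 * Re lambda * N x)).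
  { intros x Hx. destruct (K x) as [K1 K2]. unfold N. evar_last.
    - apply (is_derive_plus (V := R_NormedModule)); apply is_derive_pow; eassumption.
    - rewrite Rmax_right, <- L by exact Hx. cbn -[f]. unfold plus; cbn -[f].
      unfold Re, Im. ring. }
  assert (HN0 : forall x, 0 <= N x).
  { intros x. unfold N. pose proof (pow2_ge_0 (Re (f x))). pose proof (pow2_ge_0 (Im (f x))). lra. }
  assert (MV : forall x y, X <= x <= y -> exists c, x <= c <= y /\
    N y - N x = 2 * Re lambda * N c * (y - x)).
  { intros x y Hxy. destruct (MVT_gen N x y (fun x => 2 * Re lambda * N x)) as [c [Hc E]].
    - intros z Hz. rewrite Rmin_left, Rmax_right in Hz by lra. apply HN; lra.
    - intros z Hz. rewrite Rmin_left, Rmax_right in Hz by lra.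
      apply continuity_pt_filterlim, (ex_derive_continuous (V := R_NormedModule)).
      eexists. apply HN; lra.
    - rewrite Rmin_left, Rmax_right in Hc by lra. now exists c. }
  assert (Hmono : forall x y, X <= x <= y -> N x <= N y).
  { intros x y Hxy. destruct (MV x y Hxy) as [c [Hc E]].
    assert (0 <= 2 * Re lambda * N c * (y - x)); [|lra].
    pose proof (HN0 c). repeat apply Rmult_le_pos; lra. }
  assert (Hgr : forall y, x1 <= y -> 2 * Re lambda * N x1 * (y - x1) <= N y).
  { intros y Hy. destruct (MV x1 y) as [c [Hc E]]; [lra|].
    pose proof (Hmono x1 c ltac:(lra)). pose proof (HN0 x1).
    assert (2 * Re lambda * N x1 * (y - x1) <= 2 * Re lambda * N c * (y - x1)); [|lra].
    apply Rmult_le_compat_r; [lra|]. apply Rmult_le_compat_l; lra. }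
  assert (HNM : forall x, X <= x -> X0 <= x -> N x <= M ^ 2).
  { intros x Hx Hx0. unfold N. rewrite <- Cmod2_alt, L by exact Hx.
    apply pow_incr. split; [apply Cmod_ge_0 | now apply HM]. }
  assert (Z : N x1 = 0).
  { destruct (Req_dec (N x1) 0) as [E | E]; [exact E | exfalso].
    assert (Hp : 0 < N x1) by (pose proof (HN0 x1); lra).
    assert (Hk : 0 < 2 * Re lambda * N x1) by (repeat apply Rmult_lt_0_compat; lra).
    set (k := 2 * Re lambda * N x1) in *.
    (* Beyond [X0], and far enough for the linear lower bound of slope [k] to reach [M ^ 2 + 1]. *)
    set (y := Rmax X0 (x1 + (M ^ 2 + 1) / k)).
    assert (Hd : 0 < (M ^ 2 + 1) / k).
    { apply Rdiv_lt_0_compat; [|exact Hk]. pose proof (pow2_ge_0 M). lra. }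
    assert (Hy1 : x1 + (M ^ 2 + 1) / k <= y) by apply Rmax_r.
    assert (Hy2 : X0 <= y) by apply Rmax_l.
    pose proof (Hgr y ltac:(lra)) as G. pose proof (HNM y ltac:(lra) Hy2).
    assert (k * ((M ^ 2 + 1) / k) <= k * (y - x1)) by (apply Rmult_le_compat_l; lra).
    replace (k * ((M ^ 2 + 1) / k)) with (M ^ 2 + 1) in * by (field; lra). lra. }
  apply Cmod_eq_0. unfold N in Z. rewrite <- Cmod2_alt, L in Z by exact Hx1.
  apply Rsqr_0_uniq. unfold Rsqr. lra.
Qed.

(** A Landau-type interpolation. Over [x, x + 1] the derivative varies by at most 2 M, so Y (x + 1)
    - Y x differs from Y1 x by at most 4 M, and is itself at most 2 M. *)
Lemma derivative_bounded (X X0 M : R) (Y Y1 Y2 : R -> C) : X <= X0 ->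
  (forall x, X <= x -> is_derive_ge X Y x (Y1 x)) ->
  (forall x, X <= x -> is_derive_ge X Y1 x (Y2 x)) ->
  (forall x, X0 <= x -> Cmod (Y x) <= M) -> (forall x, X0 <= x -> Cmod (Y2 x) <= M) ->
  forall x, X0 <= x -> Cmod (Y1 x) <= 6 * M.
Proof.
  intros HX H1 H2 HY HY2 x Hx.
  assert (HM : 0 <= M) by (eapply Rle_trans; [apply Cmod_ge_0 | now apply (HY x)]).
  assert (V1 : forall y, x <= y <= x + 1 -> Cmod (Y1 y - Y1 x) <= 2 * M).
  { intros y Hy. eapply Rle_trans.
    - apply (is_derive_ge_variation x Y1 Y2 M y); [lra | |].
      + intros z Hz. apply (is_derive_ge_mono X); [lra|]. apply H2; lra.
      + intros z Hz. apply HY2; lra.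
    - nra. }
  assert (V2 : Cmod ((Y (x + 1)%R + - (1) * (RtoC (x + 1) * Y1 x))
                     - (Y x + - (1) * (RtoC x * Y1 x))) <= 2 * (2 * M) * (x + 1 - x)).
  { apply (is_derive_ge_variation x (fun y => Y y + - (1) * (RtoC y * Y1 x))%C
      (fun y => Y1 y + - (1) * Y1 x)%C); [lra | |].
    - intros z Hz. apply is_derive_ge_plus; [exact Hz | |].
      + apply (is_derive_ge_mono X); [lra|]. apply H1; lra.
      + apply is_derive_ge_cmult; [exact Hz|]. now apply is_derive_ge_linear.
    - intros z Hz. replace (Y1 z + - (1) * Y1 x)%C with (Y1 z - Y1 x)%C by ring. now apply V1. }
  pose proof (HY x Hx). pose proof (HY (x + 1) ltac:(lra)).
  replace (Y1 x) with (- ((Y (x + 1)%R + - (1) * (RtoC (x + 1) * Y1 x))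
                     - (Y x + - (1) * (RtoC x * Y1 x))) + (Y (x + 1)%R + - Y x))%C.
  2:{ rewrite RtoC_plus. ring. }
  eapply Rle_trans; [apply Cmod_triangle|]. rewrite Cmod_opp.
  pose proof (Cmod_triangle (Y (x + 1)) (- Y x)). rewrite Cmod_opp in *. lra.
Qed.

(** Balls of C are taken componentwise: radius 1 gives modulus at most 2. Finitely many levels share
    one threshold. *)
Lemma filterlim_eventually_bounded (F : nat -> R -> C) (m : nat) :
  (forall k, filterlim (F k) (Rbar_locally p_infty) (locally (RtoC 0))) ->
  exists X0, forall x, X0 <= x -> forall k, (k <= m)%nat -> Cmod (F k x) <= 2.
Proof.
  intros H.
  assert (B : forall k, exists X0, forall x, X0 <= x -> Cmod (F k x) <= 2).
  { intros k. destruct (H k (fun z => ball (RtoC 0) (mkposreal 1 Rlt_0_1) z)) as [X0 HX0].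
    { apply locally_ball. }
    exists (X0 + 1). intros x Hx. destruct (HX0 x ltac:(lra)) as [B1 B2].
    change (Rabs (Re (F k x) - 0) < 1) in B1. change (Rabs (Im (F k x) - 0) < 1) in B2.
    rewrite Rminus_0_r in B1, B2.
    replace (F k x) with (RtoC (Re (F k x)) + Ci * RtoC (Im (F k x)))%C
      by (apply C_ext; destruct (F k x); cbn; ring).
    eapply Rle_trans; [apply Cmod_triangle|].
    rewrite Cmod_mult, Cmod_Ci, !Cmod_R. lra. }
  induction m as [|m [X1 H1]].
  - destruct (B O) as [X0 H0]. exists X0. intros x Hx k Hk.
    replace k with O by lia. now apply H0.
  - destruct (B (S m)) as [X2 H2]. exists (Rmax X1 X2). intros x Hx k Hk.
    pose proof (Rmax_l X1 X2). pose proof (Rmax_r X1 X2).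
    destruct (Nat.eq_dec k (S m)) as [-> | E]; [apply H2; lra | apply H1; [lra | lia]].
Qed.

(** Generating functions [(1 + z) / 2] and [Cconj a + a z]: averaging in time, and the
    right-hand side of the semi-discrete equation solved for the second derivative. *)
Definition avg_coef (l : nat) : C := match l with 0 | 1 => (/ 2)%C | _ => RtoC 0 end.
Definition ode_coef (a : C) (l : nat) : C :=
  match l with 0 => Cconj a | 1 => a | _ => RtoC 0 end.

Lemma conv_two_terms (u v : nat -> C) (m : nat) :
  (forall l, u (S (S l)) = RtoC 0) ->
  conv u v (S m) = (u 0%nat * v (S m) + u 1%nat * v m)%C.
Proof.
  intros Hu.
  assert (Z : forall w k, conv (fun _ => RtoC 0) w k = RtoC 0).
  { intros w k. induction k as [|k IH]; cbn [conv]; [ring|]. rewrite IH. ring. }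
  destruct m as [|m]; cbn [conv]; [ring|].
  rewrite (conv_ext (fun l => u (S (S l))) (fun _ => RtoC 0) v v m), Z by auto. ring.
Qed.

Lemma sd_conv_kernel_factor (a : C) (m : nat) : a <> 0 ->
  conv avg_coef (ode_coef a) m = conv (sd_conv_kernel a) (sd_conv_kernel a) m.
Proof.
  intros Ha. destruct (sd_conv_kernel_square a Ha) as [E0 [E1 [E2 E3]]].
  destruct m as [|[|[|m]]]; [rewrite E0 | rewrite E1 | rewrite E2 | rewrite E3].
  - cbn. field.
  - rewrite re_alt. cbn. field.
  - cbn. field.
  - rewrite conv_two_terms by reflexivity. cbn. ring.
Qed.

(** This value is a negative multiple of the conjugate of s = [half_cis (2 * a)], and Im a > 0
    forces Re s > 0. The sign makes the defect of the transparent condition a growing function. *)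
Lemma sd_conv_kernel_0 (a : C) : a <> 0 -> 0 < Im a -> Re (sd_conv_kernel a 0) < 0.
Proof.
  intros Ha Him.
  assert (Ha2 : (2 * a)%C <> 0).
  { intros E. apply Ha. replace a with (/ 2 * (2 * a))%C by field. rewrite E. ring. }
  assert (Hm : 0 < Cmod (2 * a)) by now apply Cmod_gt_0.
  unfold sd_conv_kernel. rewrite Rker_leg_coef, leg_coef_0, c0_half_cis, alpha_hat_quarter.
  pose proof (half_cis_sqr _ Ha2) as E. pose proof (half_cis_Re (2 * a)) as Hre.
  pose proof (half_cis_Im _ Ha2) as Hi.
  assert (Him2 : Im (2 * a) = 2 * Im a) by (destruct a; cbn; ring).
  specialize (Hre ltac:(lra)).
  assert (E' : Cmod (2 * a) * (2 * Re (half_cis (2 * a)) * Im (half_cis (2 * a))) = 2 * Im a).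
  { rewrite <- Him2. rewrite <- E at 4. destruct (half_cis (2 * a)); cbn. ring. }
  assert (0 < Re (half_cis (2 * a))).
  { destruct (Req_dec (Re (half_cis (2 * a))) 0) as [Z | Z]; [|lra].
    rewrite Z in E'. lra. }
  assert (0 < sqrt (Cmod (2 * a))) by now apply sqrt_lt_R0.
  set (q := sqrt _) in *. destruct (half_cis (2 * a)) as [u v]; cbn in *. nra.
Qed.

Section Transparent.
Variables (X : R) (a : C) (Psi P1 : nat -> R -> C).
Hypotheses (Ha : a <> 0) (Him : 0 < Im a).
Hypothesis HPsi0 : forall x, X <= x -> Psi O x = RtoC 0.
Hypothesis HP0 : forall x, X <= x -> P1 O x = RtoC 0.
Hypothesis HP1 : forall m x, X <= x -> is_derive_ge X (Psi m) x (P1 m x).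
Hypothesis HP2 : forall m x, X <= x ->
  is_derive_ge X (fun y => conv avg_coef (fun k => P1 k y) (S m)) x
    (conv (ode_coef a) (fun k => Psi k x) (S m)).
Hypothesis Hlim :
  forall m, filterlim (Psi m) (Rbar_locally p_infty) (locally (RtoC 0)).

Let g := sd_conv_kernel a.
(* [W] is the defect in the transparent condition at the point [x].  As [g^2] has generating
   function [(1 + z) / 2 * (Cconj a + a z)], it satisfies [(1 + z) / 2 * W' = - g * W], so its
   first nonzero term would grow exponentially. *)
Let W m x := (conv avg_coef (fun k => P1 k x) m + - (1) * conv g (fun k => Psi k x) m)%C.
Let dW m x := (conv (ode_coef a) (fun k => Psi k x) m + - (1) * conv g (fun k => P1 k x) m)%C.

(** Level 0 is separate: the scheme starts at level 1, and level 0 vanishes only on the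
    half-line. *)
Lemma transparent_dW (m : nat) (x : R) : X <= x -> is_derive_ge X (W m) x (dW m x).
Proof.
  intros Hx. unfold W, dW. apply is_derive_ge_plus; [exact Hx | |].
  - destruct m as [|m]; [|now apply HP2]. cbn. rewrite HPsi0 by exact Hx.
    rewrite Cmult_0_r. apply (is_derive_ge_ext X (fun _ => RtoC 0)); [exact Hx | |].
    + intros y Hy. rewrite HP0 by exact Hy. ring.
    + now apply is_derive_ge_const.
  - apply is_derive_ge_cmult; [exact Hx|]. apply is_derive_ge_conv; [exact Hx|].
    intros k _. now apply HP1.
Qed.

(** As avg * ode = g * g, the product avg * (ode * Psi - g * P1) equals g * (g * Psi - avg * P1). *)
Lemma transparent_recursion (m : nat) (x : R) :
  conv avg_coef (fun k => dW k x) m = (- (1) * conv g (fun k => W k x) m)%C.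
Proof.
  unfold dW, W.
  rewrite conv_comm, conv_plus_l, conv_scal_l.
  rewrite !(conv_comm _ avg_coef).
  rewrite (conv_comm g (fun k => _ + _)%C), conv_plus_l, conv_scal_l.
  rewrite !(conv_comm _ g). rewrite !conv_assoc.
  rewrite (conv_ext (conv avg_coef (ode_coef a)) (conv g g) (fun k => Psi k x) (fun k => Psi k x) m)
    by (intros; auto using sd_conv_kernel_factor).
  rewrite (conv_ext (conv avg_coef g) (conv g avg_coef) (fun k => P1 k x) (fun k => P1 k x) m)
    by (intros; auto using conv_comm).
  ring.
Qed.

(** The averaged [P1] is controlled by interpolation between the averaged [Psi] and its second
    derivative, both bounded far out because [Psi] tends to 0. *)
Lemma transparent_bounded (m : nat) :
  exists X0 M, forall x, X0 <= x -> Cmod (W m x) <= M.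
Proof.
  destruct (filterlim_eventually_bounded Psi m Hlim) as [X1 H1].
  destruct (conv_bounded g m) as [Mg [HMg Hg]].
  destruct (conv_bounded avg_coef m) as [Ms [HMs Hs]].
  destruct (conv_bounded (ode_coef a) m) as [Mo [HMo Ho]].
  set (X0 := Rmax X X1).
  assert (HX0 : X <= X0) by apply Rmax_l. assert (HX1 : X1 <= X0) by apply Rmax_r.
  assert (HY : forall x, X0 <= x -> Cmod (conv avg_coef (fun k => P1 k x) m) <= 6 * (Ms + Mo)).
  { intros x Hx. destruct m as [|m].
    - cbn. rewrite HP0, Cmult_0_r, Cmod_0 by lra. lra.
    - apply (derivative_bounded X X0 _ (fun y => conv avg_coef (fun k => Psi k y) (S m))
       (fun y => conv avg_coef (fun k => P1 k y) (S m))
       (fun y => conv (ode_coef a) (fun k => Psi k y) (S m))); try lra.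
      + intros y Hy. apply is_derive_ge_conv; [exact Hy|]. intros k _. now apply HP1.
      + intros y Hy. now apply HP2.
      + intros y Hy. assert (Cmod (conv avg_coef (fun k => Psi k y) (S m)) <= Ms); [|lra].
        apply Hs. apply H1. lra.
      + intros y Hy. assert (Cmod (conv (ode_coef a) (fun k => Psi k y) (S m)) <= Mo); [|lra].
        apply Ho. apply H1. lra. }
  exists X0, (6 * (Ms + Mo) + Mg). intros x Hx. unfold W.
  eapply Rle_trans; [apply Cmod_triangle|].
  replace (- (1) * conv g (fun k => Psi k x) m)%C
    with (- conv g (fun k => Psi k x) m)%C by ring.
  rewrite Cmod_opp. apply Rplus_le_compat; [now apply HY|]. apply Hg, H1. lra.
Qed.

Lemma transparent_zero (m : nat) : forall x, X <= x -> W m x = RtoC 0.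
Proof.
  induction m as [m IH] using (well_founded_induction lt_wf).
  assert (D0 : forall j x, (j < m)%nat -> X <= x -> dW j x = RtoC 0).
  { intros j x Hj Hx. apply (is_derive_ge_unique X (W j) x); [exact Hx | |].
    - now apply transparent_dW.
    - apply (is_derive_ge_ext X (fun _ => RtoC 0)); [exact Hx | |].
      + intros y Hy. symmetry. now apply IH.
      + now apply is_derive_ge_const. }
  destruct (transparent_bounded m) as [X0 [M HM]].
  (* Once the lower terms vanish, the recursion reduces to (1 / 2) W_m' = - g_0 W_m, hence the rate
     - 2 g_0, of positive real part. *)
  apply (growing_bounded_zero X X0 M (- (2) * g O)%C (W m)); [| | exact HM].
  - pose proof (sd_conv_kernel_0 a Ha Him). unfold g. destruct (sd_conv_kernel a 0); cbn in *. lra.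
  - intros x Hx.
    replace (- (2) * g O * W m x)%C with (dW m x); [now apply transparent_dW|].
    pose proof (transparent_recursion m x) as E.
    rewrite conv_low_vanish in E by (intros j Hj; now apply D0).
    rewrite conv_low_vanish in E by (intros j Hj; now apply IH).
    replace (dW m x) with (2 * (avg_coef 0 * dW m x))%C by (cbn; field).
    rewrite E. ring.
Qed.
End Transparent.

(** * From the scheme to the boundary flux *)

Lemma ahat_Im (hbar rho B V tau : R) :
  0 < hbar -> 0 < rho -> 0 < B -> 0 < tau -> 0 < Im (ahat hbar rho B V tau).
Proof. intros. cbn. apply Rdiv_lt_0_compat; repeat apply Rmult_lt_0_compat; lra. Qed.

Lemma Im_pos_neq0 (a : C) : 0 < Im a -> a <> 0.
Proof. intros H E. rewrite E in H. cbn in H. lra. Qed.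

(** Since (hbar^2 B / 2) a = V / 2 + i hbar rho / tau, the new level [q] carries [Cconj a] and the
    old level [p] carries [a]. *)
Lemma sd_equation_iff (hbar rho B V tau : R) (p q y2 : C) :
  0 < hbar -> 0 < rho -> 0 < B -> 0 < tau ->
  let a := ahat hbar rho B V tau in
  (Ci * RtoC (hbar * rho) * ((q - p) / RtoC tau)
    = RtoC (- (hbar ^ 2 / 2 * B)) * y2 + RtoC V * ((p + q) / 2))%C
  <-> y2 = (Cconj a * q + a * p)%C.
Proof.
  intros Hh Hr HB Ht a.
  assert (Hk : RtoC (hbar ^ 2 / 2 * B) <> 0).
  { apply RtoC_neq0. assert (0 < hbar ^ 2 / 2 * B); [|lra].
    apply Rmult_lt_0_compat; [|lra]. apply Rdiv_lt_0_compat; [|lra]. nra. }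
  assert (E : (RtoC (hbar ^ 2 / 2 * B) * (Cconj a * q + a * p)
    = RtoC V * ((p + q) / 2) - Ci * RtoC (hbar * rho) * ((q - p) / RtoC tau))%C).
  { unfold a, ahat. rewrite <- (Cmult_1_l ((p + q) / 2)).
    unfold Cdiv. rewrite <- !RtoC_inv by lra.
    apply C_ext; destruct p, q; cbn; field; lra. }
  rewrite RtoC_opp. split.
  - intros H.
    replace y2 with (/ RtoC (hbar ^ 2 / 2 * B) * (RtoC (hbar ^ 2 / 2 * B) * y2))%C
      by (field; exact Hk).
    replace (RtoC (hbar ^ 2 / 2 * B) * y2)%C with (RtoC V * ((p + q) / 2)
      - (- RtoC (hbar ^ 2 / 2 * B) * y2 + RtoC V * ((p + q) / 2)))%C by ring.
    rewrite <- H, <- E. field; exact Hk.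
  - intros ->. replace (- RtoC (hbar ^ 2 / 2 * B) * (Cconj a * q + a * p))%C
      with (- (RtoC (hbar ^ 2 / 2 * B) * (Cconj a * q + a * p)))%C by ring.
    rewrite E. ring.
Qed.

(** Inverts the time average from a zero start. The scheme supplies derivatives of averages only;
    applied to them, this yields those of the levels [Psi m]. *)
Fixpoint unavg (Y : nat -> R -> C) (m : nat) (x : R) : C :=
  match m with O => RtoC 0 | S k => (2 * Y m x + - (1) * unavg Y k x)%C end.

(** The defect vanishes on the whole half-line; at [X] this identifies the derivative of the average
    with the convolution of the boundary data. *)
Lemma sd_solution_flux (hbar rho B V tau X : R) (Phi : nat -> C) (Psi : nat -> R -> C) (m : nat) :
  0 < hbar -> 0 < rho -> 0 < B -> 0 < tau ->
  sd_solution hbar rho B V tau X Phi Psi -> (1 <= m)%nat ->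
  is_derive_ge X (st_bar Psi m) X
    (conv (sd_conv_kernel (ahat hbar rho B V tau)) Phi m).
Proof.
  intros Hh Hr HB Ht [[Y1 [Y2 HY]] [H0 [HX Hlim]]] Hm.
  set (a := ahat hbar rho B V tau).
  assert (Him : 0 < Im a) by now apply ahat_Im.
  pose proof (Im_pos_neq0 a Him) as Ha.
  set (P1 := unavg Y1).
  assert (HP1 : forall m x, X <= x -> is_derive_ge X (Psi m) x (P1 m x)).
  { intros k x Hx. induction k as [|k IH]; cbn.
    - apply (is_derive_ge_ext X (fun _ => RtoC 0)); [exact Hx | |].
      + intros y Hy. symmetry. now apply H0.
      + now apply is_derive_ge_const.
    - apply (is_derive_ge_ext X (fun y => 2 * st_bar Psi (S k) y + - (1) * Psi k y)%C);
        [exact Hx | |].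
      + intros y Hy. unfold st_bar; cbn [pred]. field.
      + apply is_derive_ge_plus; [exact Hx | |]; apply is_derive_ge_cmult; try exact Hx.
        * apply HY; [lia | exact Hx].
        * exact IH. }
  assert (HA : forall m y, conv avg_coef (fun k => P1 k y) (S m) = Y1 (S m) y).
  { intros k y. rewrite conv_two_terms by reflexivity. cbn. field. }
  assert (HP2 : forall m x, X <= x ->
    is_derive_ge X (fun y => conv avg_coef (fun k => P1 k y) (S m)) x
      (conv (ode_coef a) (fun k => Psi k x) (S m))).
  { intros k x Hx. destruct (HY (S k) x ltac:(lia) Hx) as [_ [D2 E]].
    apply (is_derive_ge_ext X (Y1 (S k))); [exact Hx | |].
    - intros y _. now rewrite HA.
    - rewrite conv_two_terms by reflexivity. cbn [ode_coef].
      unfold dt_bar, st_bar in E. cbn [pred] in E.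
      apply sd_equation_iff in E; try assumption. fold a in E. now rewrite <- E. }
  pose proof (transparent_zero X a Psi P1 Ha Him H0 (fun x _ => eq_refl) HP1 HP2 Hlim m X
    (Rle_refl X)) as Z. cbv beta in Z.
  destruct m as [|m]; [lia|]. rewrite HA in Z.
  rewrite (conv_ext _ _ Phi (fun k => Psi k X) (S m) (fun l _ => eq_refl)
    (fun l _ => eq_sym (HX l))).
  set (c := conv _ _ (S m)) in *.
  replace c with (Y1 (S m) X).
  - apply HY; [lia | apply Rle_refl].
  - replace (Y1 (S m) X) with ((Y1 (S m) X + - (1) * c) + c)%C by ring. rewrite Z. ring.
Qed.

(** * Existence of decaying solutions *)

(** [s^n exp (- lambda s)] at [s = x - X] *)
Definition exp_mono (X : R) (lambda : C) (n : nat) (x : R) : C :=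
  (RtoC ((x - X) ^ n * exp (- (Re lambda * (x - X)))) * cis (- (Im lambda * (x - X))))%C.

(** At n = 0 the default [pred 0 = 0] is harmless: its term carries the factor [INR 0]. *)
Lemma exp_mono_derive (X : R) (lambda : C) (n : nat) (x : R) : X <= x ->
  is_derive_ge X (exp_mono X lambda n) x
    (RtoC (INR n) * exp_mono X lambda (pred n) x + - lambda * exp_mono X lambda n x)%C.
Proof.
  intros Hx. destruct lambda as [p q].
  apply is_derive_ge_of_components; [exact Hx | |]; unfold exp_mono, cis; cbn -[INR pow].
  - auto_derive; [trivial|]. change (x + - X) with (x - X). destruct n as [|n]; cbn [pred]; [cbn|]; ring.
  - auto_derive; [trivial|]. change (x + - X) with (x - X). destruct n as [|n]; cbn [pred]; [cbn|]; ring.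
Qed.

Lemma exp_mono_lim (X : R) (lambda : C) (n : nat) : 0 < Re lambda ->
  forall eps, 0 < eps -> exists X0, forall x, X0 < x -> Cmod (exp_mono X lambda n x) < eps.
Proof.
  intros Hp eps He. set (p := Re lambda) in *.
  pose proof (pos_INR n) as Hn.
  (* With t = s / r, exp (p s) = (exp t)^(n+1) >= t^(n+1) = s^(n+1) / K. The modulus is thus at most
     K / s, hence the threshold X + K / eps. *)
  set (r := (INR n + 1) / p). assert (Hr : 0 < r) by (apply Rdiv_lt_0_compat; lra).
  set (K := r ^ S n). assert (HK : 0 < K) by now apply pow_lt.
  exists (X + K / eps). intros x Hx.
  assert (Hd : 0 < K / eps) by now apply Rdiv_lt_0_compat.
  set (s := x - X). assert (Hs : K / eps < s) by (unfold s; lra).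
  assert (Hs0 : 0 < s) by lra.
  unfold exp_mono. rewrite Cmod_mult, Cmod_cis, Cmod_R, Rmult_1_r. fold p s.
  assert (Hsn : 0 < s ^ n) by now apply pow_lt.
  rewrite exp_Ropp, Rabs_pos_eq.
  2:{ apply Rmult_le_pos; [lra|]. left. apply Rinv_0_lt_compat, exp_pos. }
  assert (Hexp : s ^ S n / K <= exp (p * s)).
  { assert (Hsr : 0 < s / r) by now apply Rdiv_lt_0_compat.
    assert (G : forall k, (s / r) ^ k <= exp (INR k * (s / r))).
    { induction k as [|k IH]; [cbn; rewrite Rmult_0_l, exp_0; lra|].
      rewrite S_INR, Rmult_plus_distr_r, Rmult_1_l, exp_plus. cbn [pow].
      rewrite Rmult_comm. apply Rmult_le_compat; try lra.
      - apply pow_le; lra.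
      - pose proof (exp_ineq1_le (s / r)). lra. }
    specialize (G (S n)). rewrite S_INR in G.
    replace ((INR n + 1) * (s / r)) with (p * s) in G by (unfold r; field; lra).
    unfold K. unfold Rdiv in *. rewrite Rpow_mult_distr, pow_inv in G by lra. exact G. }
  pose proof (exp_pos (p * s)) as Hep.
  apply (Rmult_lt_reg_r (exp (p * s))); [exact Hep|].
  rewrite Rmult_assoc, Rinv_l, Rmult_1_r by lra.
  apply Rlt_le_trans with (eps * (s ^ S n / K)); [|apply Rmult_le_compat_l; lra].
  replace (eps * (s ^ S n / K)) with (s ^ n * (s / (K / eps))) by (cbn [pow]; field; split; lra).
  rewrite <- (Rmult_1_r (s ^ n)) at 1. apply Rmult_lt_compat_l; [exact Hsn|].
  apply (Rmult_lt_reg_r (K / eps)); [exact Hd|]. unfold Rdiv at 2.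
  rewrite Rmult_assoc, Rinv_l; lra.
Qed.

(** Polynomials times one exponential. Each time step inverts the same operator, so a single
    [lambda] serves all levels, while resonance may raise the degree. *)
Inductive exp_poly (X : R) (lambda : C) : (R -> C) -> Prop :=
| exp_poly_zero : exp_poly X lambda (fun _ => RtoC 0)
| exp_poly_mono n : exp_poly X lambda (exp_mono X lambda n)
| exp_poly_lin c f g : exp_poly X lambda f -> exp_poly X lambda g ->
    exp_poly X lambda (fun x => c * f x + g x)%C.

Lemma exp_poly_lim (X : R) (lambda : C) (f : R -> C) : 0 < Re lambda ->
  exp_poly X lambda f ->
  forall eps, 0 < eps -> exists X0, forall x, X0 < x -> Cmod (f x) < eps.
Proof.
  intros Hl Hf. induction Hf as [|n|c f g _ IHf _ IHg]; intros eps He.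
  - exists 0. intros x _. now rewrite Cmod_0.
  - now apply exp_mono_lim.
  - pose proof (Cmod_ge_0 c) as Hc.
    destruct (IHf (eps / 2 / (Cmod c + 1))) as [X1 H1]; [repeat apply Rdiv_lt_0_compat; lra|].
    destruct (IHg (eps / 2)) as [X2 H2]; [lra|].
    exists (Rmax X1 X2). intros x Hx.
    pose proof (Rmax_l X1 X2). pose proof (Rmax_r X1 X2).
    specialize (H1 x ltac:(lra)). specialize (H2 x ltac:(lra)).
    eapply Rle_lt_trans; [apply Cmod_triangle|]. rewrite Cmod_mult.
    assert (Cmod c * Cmod (f x) <= eps / 2); [|lra].
    replace (eps / 2) with ((Cmod c + 1) * (eps / 2 / (Cmod c + 1))) by (field; lra).
    apply Rmult_le_compat; [lra | apply Cmod_ge_0 | lra | lra].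
Qed.

Lemma exp_poly_filterlim (X : R) (lambda : C) (f : R -> C) : 0 < Re lambda ->
  exp_poly X lambda f -> filterlim f (Rbar_locally p_infty) (locally (RtoC 0)).
Proof.
  intros Hl Hf P [eps HP]. destruct (exp_poly_lim X lambda f Hl Hf eps (cond_pos eps)) as [X0 H].
  exists X0. intros x Hx. apply HP. specialize (H x Hx).
  pose proof (Rmax_Cmod (f x)). pose proof (Rmax_l (Rabs (fst (f x))) (Rabs (snd (f x)))).
  pose proof (Rmax_r (Rabs (fst (f x))) (Rabs (snd (f x)))).
  split.
  - change (Rabs (fst (f x) - 0) < eps). rewrite Rminus_0_r. lra.
  - change (Rabs (snd (f x) - 0) < eps). rewrite Rminus_0_r. lra.
Qed.

Definition forced_solution (X : R) (lambda : C) (f Y : R -> C) : Prop :=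
  exp_poly X lambda Y /\ Y X = RtoC 0 /\ exists Y1 : R -> C,
  (forall x, X <= x -> is_derive_ge X Y x (Y1 x)) /\
  (forall x, X <= x -> is_derive_ge X Y1 x (lambda * lambda * Y x + f x)%C).

Lemma forced_solution_lin (X : R) (lambda c : C) (f g Y Z : R -> C) :
  forced_solution X lambda f Y -> forced_solution X lambda g Z ->
  forced_solution X lambda (fun x => c * f x + g x)%C (fun x => c * Y x + Z x)%C.
Proof.
  intros [HY [HY0 [Y1 [DY DY1]]]] [HZ [HZ0 [Z1 [DZ DZ1]]]].
  repeat split; [now constructor | rewrite HY0, HZ0; ring |].
  exists (fun x => c * Y1 x + Z1 x)%C. split; intros x Hx.
  - apply is_derive_ge_plus; [exact Hx | | now apply DZ].
    apply is_derive_ge_cmult; [exact Hx | now apply DY].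
  - replace (lambda * lambda * (c * Y x + Z x) + (c * f x + g x))%C
      with (c * (lambda * lambda * Y x + f x) + (lambda * lambda * Z x + g x))%C by ring.
    apply is_derive_ge_plus; [exact Hx | | now apply DZ1].
    apply is_derive_ge_cmult; [exact Hx | now apply DY1].
Qed.

Lemma forced_solution_ext (X : R) (lambda : C) (f g Y : R -> C) :
  (forall x, f x = g x) -> forced_solution X lambda f Y -> forced_solution X lambda g Y.
Proof.
  intros E [HY [HY0 [Y1 [DY DY1]]]]. repeat split; [exact HY | exact HY0 |].
  exists Y1. split; [exact DY|]. intros x Hx. rewrite <- E. now apply DY1.
Qed.

Lemma forced_solution_zero (X : R) (lambda : C) :
  forced_solution X lambda (fun _ => RtoC 0) (fun _ => RtoC 0).
Proof.
  repeat split; [constructor|]. exists (fun _ => RtoC 0). split; intros x Hx.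
  - now apply is_derive_ge_const.
  - replace (_ + _)%C with (RtoC 0) by ring. now apply is_derive_ge_const.
Qed.

Lemma exp_mono_derive2 (X : R) (lambda : C) (n : nat) (x : R) : X <= x ->
  is_derive_ge X
    (fun y => RtoC (INR n) * exp_mono X lambda (pred n) y + - lambda * exp_mono X lambda n y)%C x
    (RtoC (INR n) * (RtoC (INR (pred n)) * exp_mono X lambda (pred (pred n)) x
       + - lambda * exp_mono X lambda (pred n) x)
     + - lambda * (RtoC (INR n) * exp_mono X lambda (pred n) x
       + - lambda * exp_mono X lambda n x))%C.
Proof.
  intros Hx. apply is_derive_ge_plus; [exact Hx | |];
    (apply is_derive_ge_cmult; [exact Hx | now apply exp_mono_derive]).
Qed.

(** The forcing is resonant with the homogeneous solution, so a power of s is gained; the factor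
    s^(n+1) also gives the zero boundary value. *)
Lemma exp_mono_forced_solution (X : R) (lambda : C) (n : nat) : lambda <> 0 ->
  exists Y, forced_solution X lambda (exp_mono X lambda n) Y.
Proof.
  intros Hl.
  (* [Y_n = (- E_(n+1) / (n + 1) + n Y_(n-1)) / (2 lambda)] where [E_n] is the forcing term *)
  assert (Hstep : forall n Z,
    forced_solution X lambda (fun x => RtoC (INR n) * exp_mono X lambda (pred n) x)%C Z ->
    exists Y, forced_solution X lambda (exp_mono X lambda n) Y).
  { clear n. intros n Z [HZ [HZ0 [Z1 [DZ DZ1]]]].
    set (k := (/ (2 * lambda))%C).
    set (c := (- (k / RtoC (INR (S n))))%C).
    assert (Hn : RtoC (INR n + 1) <> 0).
    { apply RtoC_neq0. pose proof (pos_INR n). lra. }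
    exists (fun x => c * exp_mono X lambda (S n) x + (k * Z x + RtoC 0))%C. repeat split.
    - constructor; [constructor|]. constructor; [exact HZ | constructor].
    - rewrite HZ0. unfold exp_mono. rewrite Rminus_diag. cbn [pow].
      rewrite !Rmult_0_l. ring.
    - exists (fun x => c * (RtoC (INR (S n)) * exp_mono X lambda n x
         + - lambda * exp_mono X lambda (S n) x) + (k * Z1 x + RtoC 0))%C.
      split; intros x Hx.
      + apply is_derive_ge_plus; [exact Hx | |].
        * apply is_derive_ge_cmult; [exact Hx|]. now apply (exp_mono_derive X lambda (S n)).
        * apply is_derive_ge_plus; [exact Hx | |now apply is_derive_ge_const].
          apply is_derive_ge_cmult; [exact Hx | now apply DZ].
      + pose proof (exp_mono_derive2 X lambda (S n) x Hx) as D2. cbn [pred] in D2.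
        match goal with |- is_derive_ge _ _ _ ?l => set (rhs := l) end.
        replace rhs with (c * (RtoC (INR (S n)) * (RtoC (INR n) * exp_mono X lambda (pred n) x
             + - lambda * exp_mono X lambda n x)
           + - lambda * (RtoC (INR (S n)) * exp_mono X lambda n x
             + - lambda * exp_mono X lambda (S n) x))
           + (k * (lambda * lambda * Z x + RtoC (INR n) * exp_mono X lambda (pred n) x)
              + RtoC 0))%C.
        * apply is_derive_ge_plus; [exact Hx | |].
          -- now apply is_derive_ge_cmult.
          -- apply is_derive_ge_plus; [exact Hx | |now apply is_derive_ge_const].
             apply is_derive_ge_cmult; [exact Hx | now apply DZ1].
        * unfold rhs, c, k. rewrite S_INR. field. now split. }
  induction n as [|n [Z HZ]].
  - apply (Hstep O (fun _ => RtoC 0)).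
    apply (forced_solution_ext X lambda (fun _ => RtoC 0)); [|apply forced_solution_zero].
    intros x. cbn [INR]. ring.
  - apply (Hstep (S n) (fun x => RtoC (INR (S n)) * Z x + RtoC 0)%C).
    apply (forced_solution_ext X lambda
      (fun x => RtoC (INR (S n)) * exp_mono X lambda n x + RtoC 0)%C).
    + intros x. cbn [pred]. ring.
    + apply forced_solution_lin; [exact HZ | apply forced_solution_zero].
Qed.

Lemma exp_poly_forced_solution (X : R) (lambda : C) (f : R -> C) : lambda <> 0 ->
  exp_poly X lambda f -> exists Y, forced_solution X lambda f Y.
Proof.
  intros Hl Hf. induction Hf as [|n|c f g _ [Y IHf] _ [Z IHg]].
  - eexists. apply forced_solution_zero.
  - now apply exp_mono_forced_solution.
  - eexists. apply forced_solution_lin; eassumption.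
Qed.

(** The boundary value is added through the homogeneous solution [exp_mono X lambda 0], equal to 1
    at [X]. *)
Lemma exp_poly_bvp (X : R) (lambda c y0 : C) (f : R -> C) : lambda <> 0 ->
  exp_poly X lambda f -> exists Y, exp_poly X lambda Y /\ Y X = y0 /\ exists Y1 : R -> C,
  (forall x, X <= x -> is_derive_ge X Y x (Y1 x)) /\
  (forall x, X <= x -> is_derive_ge X Y1 x (lambda * lambda * Y x + c * f x)%C).
Proof.
  intros Hl Hf. destruct (exp_poly_forced_solution X lambda f Hl Hf) as [Y [HY [HY0 [Y1 [DY DY1]]]]].
  exists (fun x => c * Y x + (y0 * exp_mono X lambda 0 x + RtoC 0))%C. repeat split.
  - constructor; [exact HY|]. repeat constructor.
  - rewrite HY0. unfold exp_mono, cis. rewrite Rminus_diag, !Rmult_0_r, Ropp_0, exp_0, cos_0, sin_0.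
    apply C_ext; destruct c, y0; cbn; ring.
  - exists (fun x => c * Y1 x + (y0 * (RtoC (INR 0) * exp_mono X lambda 0 x
         + - lambda * exp_mono X lambda 0 x) + RtoC 0))%C.
    split; intros x Hx.
    + apply is_derive_ge_plus; [exact Hx | |].
      * apply is_derive_ge_cmult; [exact Hx | now apply DY].
      * apply is_derive_ge_plus; [exact Hx | |now apply is_derive_ge_const].
        apply is_derive_ge_cmult; [exact Hx | now apply (exp_mono_derive X lambda 0)].
    + match goal with |- is_derive_ge _ _ _ ?l => set (rhs := l) end.
      pose proof (exp_mono_derive2 X lambda 0 x Hx) as D2. cbn [pred] in D2.
      match type of D2 with is_derive_ge _ _ _ ?l => set (d2 := l) in D2 end.
      replace rhs with (c * (lambda * lambda * Y x + f x) + (y0 * d2 + RtoC 0))%C.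
      * apply is_derive_ge_plus; [exact Hx | |].
        -- apply is_derive_ge_cmult; [exact Hx | now apply DY1].
        -- apply is_derive_ge_plus; [exact Hx | |now apply is_derive_ge_const].
           now apply is_derive_ge_cmult.
      * unfold rhs, d2. cbn [INR]. ring.
Qed.

(** The half-direction of [Cconj z] lies in the open first quadrant; its conjugate, suitably scaled,
    is the required root. *)
Lemma decaying_sqrt (z : C) : Im z < 0 -> exists lambda, (lambda * lambda = z)%C /\ 0 < Re lambda.
Proof.
  intros Hz. assert (Hzc : Cconj z <> 0).
  { apply Im_pos_neq0. rewrite im_conj. lra. }
  exists (RtoC (sqrt (Cmod (Cconj z))) * Cconj (half_cis (Cconj z)))%C.
  pose proof (half_cis_sqr _ Hzc) as E. pose proof (half_cis_Im _ Hzc) as Hi.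
  pose proof (half_cis_Re (Cconj z)) as Hr. rewrite im_conj in Hr. specialize (Hr ltac:(lra)).
  assert (Hm : 0 < Cmod (Cconj z)) by now apply Cmod_gt_0.
  set (s := half_cis (Cconj z)) in *.
  assert (Hq : 0 < sqrt (Cmod (Cconj z))) by now apply sqrt_lt_R0.
  assert (Hqq : (RtoC (sqrt (Cmod (Cconj z))) * RtoC (sqrt (Cmod (Cconj z)))
    = RtoC (Cmod (Cconj z)))%C) by (rewrite <- RtoC_mult, sqrt_sqrt; [reflexivity | lra]).
  set (q := sqrt _) in *. set (M := Cmod (Cconj z)) in *. split.
  - replace (RtoC q * Cconj s * (RtoC q * Cconj s))%C
      with ((RtoC q * RtoC q) * (Cconj s * Cconj s))%C by ring.
    rewrite Hqq, <- (Cconj_conj z), <- E, !Cmult_conj.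
    f_equal. apply C_ext; cbn; ring.
  - assert (Ei : M * (2 * Re s * Im s) = - Im z).
    { rewrite <- im_conj, <- E. destruct s; cbn; ring. }
    assert (0 < Re s).
    { destruct (Req_dec (Re s) 0) as [Z | Z]; [|lra]. rewrite Z in Ei. lra. }
    destruct s as [u v]; cbn in *. nra.
Qed.

(** For the average U of two consecutive levels the scheme reads U'' = 2 Cconj a U + (a - Cconj a)
    Psi_k. It is solved level by level with lambda^2 = 2 Cconj a. *)
Lemma sd_solution_exists (hbar rho B V tau X : R) (Phi : nat -> C) :
  0 < hbar -> 0 < rho -> 0 < B -> 0 < tau -> Phi O = RtoC 0 ->
  exists Psi, sd_solution hbar rho B V tau X Phi Psi.
Proof.
  intros Hh Hr HB Ht HPhi. set (a := ahat hbar rho B V tau).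
  assert (Him : 0 < Im a) by now apply ahat_Im.
  destruct (decaying_sqrt (2 * Cconj a)) as [lambda [Hl Hlp]].
  { destruct a; cbn in *; lra. }
  assert (Hl0 : lambda <> 0) by (intros E; rewrite E in Hlp; cbn in Hlp; lra).
  set (good := fun (f : R -> C) (y0 : C) (Y : R -> C) => exp_poly X lambda Y /\ Y X = y0 /\
    exists Y1 : R -> C,
    (forall x, X <= x -> is_derive_ge X Y x (Y1 x)) /\
    (forall x, X <= x -> is_derive_ge X Y1 x (lambda * lambda * Y x + (a - Cconj a) * f x)%C)).
  (* [epsilon] makes the solution a function of the forcing term, as the recursion over levels
     requires. *)
  set (solve := fun f y0 => epsilon (inhabits (fun _ : R => RtoC 0)) (good f y0)).
  assert (Hsolve : forall f y0, exp_poly X lambda f -> good f y0 (solve f y0)).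
  { intros f y0 Hf. apply epsilon_spec. now apply exp_poly_bvp. }
  (* The summand [RtoC 0] gives each level the shape of [exp_poly_lin]. *)
  set (Psi := fix Psi (m : nat) : R -> C := match m with
    | O => fun _ => RtoC 0
    | S k => fun x => (2 * solve (Psi k) ((Phi k + Phi (S k)) / 2) x + (- (1) * Psi k x + RtoC 0))%C
    end).
  assert (HE : forall m, exp_poly X lambda (Psi m)).
  { induction m as [|m IH]; [constructor|]. cbn. constructor.
    - now apply Hsolve.
    - constructor; [exact IH | constructor]. }
  assert (HX : forall m, Psi m X = Phi m).
  { induction m as [|m IH]; [now rewrite HPhi|]. cbn.
    destruct (Hsolve (Psi m) ((Phi m + Phi (S m)) / 2)%C (HE m)) as [_ [E _]].
    rewrite E, IH. field. }
  assert (Havg : forall m x, st_bar Psi (S m) x = solve (Psi m) ((Phi m + Phi (S m)) / 2)%C x).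
  { intros m x. unfold st_bar. cbn [pred]. cbn. field. }
  assert (HD : forall m, exists Y1, forall x, X <= x ->
    is_derive_ge X (st_bar Psi (S m)) x (Y1 x) /\
    is_derive_ge X Y1 x (Cconj a * Psi (S m) x + a * Psi m x)%C).
  { intros m. destruct (Hsolve (Psi m) ((Phi m + Phi (S m)) / 2)%C (HE m))
      as [_ [_ [Y1 [D1 D2]]]].
    exists Y1. intros x Hx. split.
    - apply (is_derive_ge_ext X (solve (Psi m) ((Phi m + Phi (S m)) / 2)%C)); [exact Hx | |].
      + intros y _. now rewrite Havg.
      + now apply D1.
    - replace (Cconj a * Psi (S m) x + a * Psi m x)%C with
        (lambda * lambda * solve (Psi m) ((Phi m + Phi (S m)) / 2) x
          + (a - Cconj a) * Psi m x)%C; [now apply D2|].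
      rewrite Hl. cbn. ring. }
  exists Psi. split; [|repeat split].
  - exists (fun m => match m with O => fun _ => RtoC 0 | S k =>
      epsilon (inhabits (fun _ : R => RtoC 0)) (fun Y1 => forall x, X <= x ->
        is_derive_ge X (st_bar Psi (S k)) x (Y1 x) /\
        is_derive_ge X Y1 x (Cconj a * Psi (S k) x + a * Psi k x)%C) end).
    exists (fun m x => Cconj a * Psi m x + a * Psi (pred m) x)%C.
    intros [|m] x Hm Hx; [lia|].
    pose proof (epsilon_spec (inhabits (fun _ : R => RtoC 0)) _ (HD m)) as S.
    cbv beta in S. destruct (S x Hx) as [D1 D2]. clear S.
    split; [exact D1|]. split; [exact D2|]. unfold dt_bar, st_bar.
    now apply sd_equation_iff.
  - exact HX.
  - intros m. apply (exp_poly_filterlim X lambda); [exact Hlp | apply HE].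
Qed.

(** * Identification of the semi-discrete kernel *)

Lemma sd_kernel_value (hbar rho B V tau X : R) (m : nat) :
  0 < hbar -> 0 < rho -> 0 < B -> 0 < tau ->
  (c0D hbar rho B V tau X * RD hbar rho B V tau X m)%C
  = sd_conv_kernel (ahat hbar rho B V tau) m.
Proof.
  intros Hh Hr HB Ht. set (a := ahat hbar rho B V tau). set (g := sd_conv_kernel a).
  assert (Him : 0 < Im a) by now apply ahat_Im.
  assert (Hg : g O <> 0).
  { intros E. pose proof (sd_conv_kernel_0 a (Im_pos_neq0 a Him) Him) as N.
    fold g in N. rewrite E in N. cbn in N. lra. }
  (* A witness licenses [epsilon_spec]: g normalised by its nonzero leading coefficient. *)
  assert (HK : is_sd_kernel hbar rho B V tau X (sd_kernel hbar rho B V tau X)).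
  { unfold sd_kernel. apply epsilon_spec. exists (g O, fun l => (g l / g O)%C). split.
    - field; exact Hg.
    - intros Phi Psi HPhi HPsi k Hk.
      replace (g O * _)%C with (conv g Phi k); [now apply sd_solution_flux|].
      rewrite (conv_sum_n (fun l => g l / g O)%C Phi k), <- conv_scal_l.
      apply conv_ext; intros l _; [field; exact Hg | reflexivity]. }
  unfold c0D, RD. destruct (sd_kernel hbar rho B V tau X) as [c Rs]. cbn [fst snd].
  destruct HK as [_ HK].
  (* A unit impulse at level 1, as level 0 must vanish; level [S m] of the convolution then isolates
     the coefficient of index m. *)
  set (Phi := fun l => match l with 1%nat => RtoC 1 | _ => RtoC 0 end).
  assert (Hd : forall u, conv u Phi (S m) = u m).
  { intros u. rewrite conv_comm. cbn [conv]. destruct m as [|m].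
    - cbn. ring.
    - rewrite conv_two_terms by reflexivity. cbn. ring. }
  destruct (sd_solution_exists hbar rho B V tau X Phi) as [Psi HPsi]; try assumption; [reflexivity|].
  specialize (HK Phi Psi eq_refl HPsi (S m) ltac:(lia)). rewrite conv_sum_n, Hd in HK.
  rewrite <- (Hd g). apply (is_derive_ge_unique X (st_bar Psi (S m)) X); [lra | exact HK |].
  apply sd_solution_flux; [assumption .. | lia].
Qed.

(** * Comparison of the kernels *)

Lemma leg_coef_lipschitz (m : nat) (x y : R) : Rabs x <= 1 -> Rabs y <= 1 ->
  Rabs (leg_coef x m - leg_coef y m) <= Rabs (x - y).
Proof.
  intros Hx Hy. destruct m as [|[|n]].
  - rewrite !leg_coef_0, Rminus_diag, Rabs_R0. apply Rabs_pos.
  - rewrite !leg_coef_1. replace (- x - - y) with (- (x - y)) by ring.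
    rewrite Rabs_Ropp. lra.
  - pose proof (pos_INR n) as Hn. rewrite !leg_coef_SS.
    assert (D : forall t, is_derive (fun z => Legendre (S (S n)) z - Legendre n z) t
      ((2 * INR n + 3) * Legendre (S n) t)).
    { intros t. rewrite <- dLegendre_diff.
      apply (is_derive_minus (V := R_NormedModule) (Legendre (S (S n))) (Legendre n));
        apply is_derive_Legendre. }
    destruct (MVT_gen (fun z => Legendre (S (S n)) z - Legendre n z) y x
      (fun t => (2 * INR n + 3) * Legendre (S n) t)) as [c [Hc E]].
    { intros t _. apply D. }
    { intros t _. apply continuity_pt_filterlim.
      apply (ex_derive_continuous (V := R_NormedModule)
        (fun z => Legendre (S (S n)) z - Legendre n z)).
      eexists. apply D. }
    replace (_ - _) with (- (Legendre (S n) c * (x - y))).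
    + rewrite Rabs_Ropp, Rabs_mult.
      assert (Rabs (Legendre (S n) c) <= 1).
      { apply Legendre_bound. apply Rabs_le. apply Rabs_le_between in Hx, Hy.
        revert Hc. unfold Rmin, Rmax. destruct (Rle_dec y x); lra. }
      pose proof (Rabs_pos (x - y)). nra.
    + apply (Rmult_eq_reg_r (2 * INR n + 3)); [|lra]. field_simplify; [|lra]. nra.
Qed.

Lemma leg_coef_bound (m : nat) (x : R) : Rabs x <= 1 ->
  Rabs (2 * INR m - 1) * Rabs (leg_coef x m) <= 2.
Proof.
  intros Hx. unfold leg_coef.
  assert (HL : forall k, Rabs (LegendreZ k x) <= 1).
  { intros k. unfold LegendreZ. destruct (k <? 0)%Z; [rewrite Rabs_R0; lra|].
    now apply Legendre_bound. }
  pose proof (odd_neq0 m) as Hm.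
  rewrite <- Rabs_mult.
  replace (_ * _) with (- (LegendreZ (Z.of_nat m) x - LegendreZ (Z.of_nat m - 2) x))
    by (field; exact Hm).
  rewrite Rabs_Ropp. eapply Rle_trans; [apply Rabs_triang|]. rewrite Rabs_Ropp.
  pose proof (HL (Z.of_nat m)). pose proof (HL (Z.of_nat m - 2)%Z). lra.
Qed.

Lemma unit_pow_minus_1 (w : C) (k : nat) : Cmod w = 1 ->
  Cmod (w ^ k - 1) <= INR k * Cmod (w - 1).
Proof.
  intros Hw. induction k as [|k IH].
  - cbn. replace (1 - 1)%C with (RtoC 0) by ring. rewrite Cmod_0. lra.
  - replace (w ^ S k - 1)%C with (w * (w ^ k - 1) + (w - 1))%C by (cbn; ring).
    eapply Rle_trans; [apply Cmod_triangle|]. rewrite Cmod_mult, Hw, S_INR. lra.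
Qed.

(** The product is w^(2m-1), written with the conjugate so that m = 0, of exponent -1, is
    included. *)
Lemma unit_odd_pow_minus_1 (w : C) (m : nat) : Cmod w = 1 ->
  Cmod (Cconj w * (w * w) ^ m - 1) <= Rabs (2 * INR m - 1) * Cmod (w - 1).
Proof.
  intros Hw. destruct m as [|m].
  - replace (Cconj w * (w * w) ^ 0 - 1)%C with (Cconj (w - 1)%C).
    + rewrite Cmod_conj. cbn [INR]. rewrite Rabs_left by lra. lra.
    + apply C_ext; destruct w; cbn; ring.
  - rewrite S_INR. pose proof (pos_INR m). rewrite Rabs_pos_eq by lra.
    assert (P : ((w * w) ^ m = w ^ (2 * m))%C).
    { rewrite Cpow_mult_r. f_equal. cbn. ring. }
    replace (Cconj w * (w * w) ^ S m - 1)%C with (w ^ S (2 * m) - 1)%C.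
    + eapply Rle_trans; [now apply unit_pow_minus_1|].
      rewrite S_INR, mult_INR. cbn [INR]. right. ring.
    + cbn [Cpow]. rewrite P.
      replace (Cconj w * (w * w * w ^ (2 * m)))%C
        with ((w * Cconj w) * (w * w ^ (2 * m)))%C by ring.
      rewrite (Cmod1_conj w Hw). ring.
Qed.

Section Error.
Variables (theta h : R) (a : C).
Hypotheses (Htheta : theta <= 1 / 4) (Him : 0 < Im a).
Let eps := (1 - 4 * theta) * h ^ 2.
Let at_ := alpha_tilde theta h a.
Let w := half_cis at_.

Let Heps : 0 <= eps.
Proof. unfold eps. apply Rmult_le_pos; [lra | apply pow2_ge_0]. Qed.

Let Ha : a <> 0.
Proof. now apply Im_pos_neq0. Qed.

Let HM : 0 < Cmod a.
Proof. now apply Cmod_gt_0. Qed.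

Lemma alpha_tilde_Im : 0 <= Im at_.
Proof.
  unfold at_, alpha_tilde. fold eps. destruct a as [p q]; cbn in *. nra.
Qed.

Lemma alpha_tilde_neq0 : at_ <> 0.
Proof.
  unfold at_, alpha_tilde. fold eps. intros E.
  assert (E1 := f_equal Re E). assert (E2 := f_equal Im E).
  destruct a as [p q]; cbn in *.
  assert (eps = 0) by nra. nra.
Qed.

Let HA : 0 < Cmod at_.
Proof. apply Cmod_gt_0, alpha_tilde_neq0. Qed.

Lemma alpha_hat_factor : alpha_hat theta h a = (a * at_)%C.
Proof. unfold alpha_hat, at_, alpha_tilde. ring. Qed.

Let Hww : (RtoC (Cmod at_) * (w * w))%C = at_.
Proof. apply half_cis_sqr, alpha_tilde_neq0. Qed.

Lemma Cmod_alpha_tilde_minus_2 : Rabs (Cmod at_ - 2) <= eps * Cmod a.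
Proof.
  assert (E : Cmod (at_ - 2) = eps * Cmod a).
  { unfold at_, alpha_tilde. fold eps. replace (2 + RtoC eps * a - 2)%C with (RtoC eps * a)%C by ring.
    now rewrite Cmod_mult, Cmod_R, Rabs_pos_eq. }
  assert (E2 : Cmod 2 = 2) by (rewrite Cmod_R; apply Rabs_pos_eq; lra).
  rewrite <- E. apply Rabs_le. split.
  - pose proof (Cmod_triangle at_ (- (at_ - 2))) as T. rewrite Cmod_opp in T.
    replace (at_ + - (at_ - 2))%C with (RtoC 2) in T by ring. lra.
  - pose proof (Cmod_triangle (at_ - 2) 2) as T.
    replace (at_ - 2 + 2)%C with at_ in T by ring. lra.
Qed.

(** Write at_ - |at_| = eps a - (|at_| - 2); both terms are at most eps |a|. *)
Lemma direction_alpha_tilde : Cmod (w * w - 1) <= 2 * (eps * Cmod a / Cmod at_).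
Proof.
  pose proof Cmod_alpha_tilde_minus_2 as E.
  apply (Rmult_le_reg_l (Cmod at_)); [exact HA|].
  replace (Cmod at_ * (2 * (eps * Cmod a / Cmod at_))) with (2 * (eps * Cmod a)) by (field; lra).
  replace (Cmod at_ * Cmod (w * w - 1)) with (Cmod (at_ - RtoC (Cmod at_))).
  - replace (at_ - RtoC (Cmod at_))%C with (RtoC eps * a + - RtoC (Cmod at_ - 2))%C.
    2:{ generalize (Cmod at_). intros t. unfold at_, alpha_tilde. fold eps.
        rewrite RtoC_minus. ring. }
    eapply Rle_trans; [apply Cmod_triangle|].
    rewrite Cmod_opp, Cmod_mult, !Cmod_R, (Rabs_pos_eq eps) by exact Heps. lra.
  - rewrite <- (Rabs_pos_eq (Cmod at_)) at 2 by lra. rewrite <- Cmod_R, <- Cmod_mult.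
    f_equal. rewrite <- Hww at 1. ring.
Qed.

(** Re w >= 0 gives |w + 1| >= 1, so the bound on w^2 - 1 passes to w - 1. *)
Lemma half_direction_alpha_tilde : Cmod (w - 1) <= 2 * (eps * Cmod a / Cmod at_).
Proof.
  eapply Rle_trans; [|apply direction_alpha_tilde].
  replace (w * w - 1)%C with ((w - 1) * (w + 1))%C by ring. rewrite Cmod_mult.
  assert (1 <= Cmod (w + 1)).
  { pose proof (re_le_Cmod (w + 1)) as R1. pose proof (Rle_abs (Re (w + 1))) as R2.
    assert (R3 := half_cis_Re at_ alpha_tilde_Im). fold w in R3.
    replace (Re (w + 1)) with (Re w + 1) in * by (destruct w; cbn; ring). lra. }
  pose proof (Cmod_ge_0 (w - 1)). nra.
Qed.

(** The numerator [beta_hat] is Re (Cconj a at_), so [mu] depends on at_ only through its direction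
    w^2. *)
Lemma mu_eq : mu theta h a = Re (Cconj a * (w * w)) / Cmod a.
Proof.
  unfold mu. rewrite alpha_hat_factor, Cmod_mult.
  replace (beta_hat theta h a) with (Cmod at_ * Re (Cconj a * (w * w))).
  - field. split; lra.
  - transitivity (Re (Cconj a * at_)).
    + rewrite <- Hww at 2. generalize (Cmod at_) w a. intros t [w1 w2] [p q]. cbn. ring.
    + unfold beta_hat, at_, alpha_tilde. fold eps. rewrite Cmod2_alt.
      destruct a; cbn; ring.
Qed.

Lemma mu_bound : Rabs (mu theta h a) <= 1.
Proof.
  rewrite mu_eq. unfold Rdiv. rewrite Rabs_mult, Rabs_inv, (Rabs_pos_eq (Cmod a)) by lra.
  apply (Rmult_le_reg_r (Cmod a)); [exact HM|].
  rewrite Rmult_assoc, Rinv_l, Rmult_1_r, Rmult_1_l by lra.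
  eapply Rle_trans; [apply re_le_Cmod|].
  unfold w. rewrite !Cmod_mult, Cmod_conj, Cmod_half_cis. lra.
Qed.

Lemma mu_diff : Rabs (mu theta h a - Re a / Cmod a) <= 2 * (eps * Cmod a / Cmod at_).
Proof.
  eapply Rle_trans; [|apply direction_alpha_tilde]. rewrite mu_eq.
  replace (_ - _) with (Re (Cconj a * (w * w - 1)) / Cmod a).
  - unfold Rdiv. rewrite Rabs_mult, Rabs_inv, (Rabs_pos_eq (Cmod a)) by lra.
    apply (Rmult_le_reg_r (Cmod a)); [exact HM|].
    rewrite Rmult_assoc, Rinv_l, Rmult_1_r by lra.
    eapply Rle_trans; [apply re_le_Cmod|]. rewrite Cmod_mult, Cmod_conj. lra.
  - unfold Rdiv. rewrite <- Rmult_minus_distr_r. f_equal. destruct a, w; cbn; ring.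
Qed.

(** A product of roots is a root of the product up to sign. Here both factors lie in the closed
    first quadrant and the first in its interior, so the product has positive imaginary part. *)
Lemma half_cis_alpha_hat :
  half_cis (alpha_hat theta h a) = (half_cis (2 * a) * w)%C.
Proof.
  rewrite alpha_hat_factor.
  assert (Ha2 : (2 * a)%C <> 0).
  { apply Im_pos_neq0. destruct a; cbn in *; lra. }
  pose proof (half_cis_sqr _ Ha2) as E. pose proof (half_cis_Im _ Ha2) as Hi.
  pose proof (half_cis_Re (2 * a)) as Hr.
  assert (HM2 : Cmod (2 * a) = 2 * Cmod a).
  { rewrite Cmod_mult, Cmod_R, Rabs_pos_eq; lra. }
  pose proof (half_cis_Re at_ alpha_tilde_Im) as Hwr.
  pose proof (half_cis_Im at_ alpha_tilde_neq0) as Hwi.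
  pose proof (Cmod_half_cis at_) as Hw1.
  fold w in Hwr, Hwi, Hw1. set (s := half_cis (2 * a)) in *.
  assert (I2 : Im (2 * a) = 2 * Im a) by (destruct a; cbn; ring).
  specialize (Hr ltac:(lra)).
  assert (Ei : Cmod a * (2 * Re s * Im s) = Im a).
  { apply (f_equal Im) in E. rewrite I2, HM2 in E. destruct s; cbn in *. lra. }
  assert (Hr' : 0 < Re s) by (destruct (Req_dec (Re s) 0) as [Z | Z]; [rewrite Z in Ei|]; lra).
  assert (Hi' : 0 < Im s) by (destruct (Req_dec (Im s) 0) as [Z | Z]; [rewrite Z in Ei|]; lra).
  apply half_cis_unique.
  - intros Z. apply (f_equal Cmod) in Z. rewrite Cmod_mult, Cmod_0 in Z.
    apply Rmult_integral in Z. lra.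
  - rewrite Cmod_mult, RtoC_mult.
    replace (RtoC (Cmod a) * RtoC (Cmod at_) * (s * w * (s * w)))%C
      with ((RtoC (2 * Cmod a) * (s * s)) / 2 * (RtoC (Cmod at_) * (w * w)))%C
      by (rewrite RtoC_mult; field).
    rewrite <- HM2, E, Hww. field.
  - rewrite im_mult.
    pose proof (Cmod2_alt w) as Hsq. rewrite Hw1 in Hsq.
    assert (0 <= Re s * Im w) by (apply Rmult_le_pos; lra).
    assert (0 <= Im s * Re w) by (apply Rmult_le_pos; lra).
    (* Both parts of [s] are positive, and |w| = 1 keeps the nonnegative parts of [w] from vanishing
       together. *)
    destruct (Req_dec (Re w) 0) as [Z | Z].
    + rewrite Z in *. assert (0 < Im w) by nra. nra.
    + assert (0 < Re w) by lra. nra.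
Qed.

(** With q = eps |a| / |at_| and k = |2m - 1|, the phase term is at most (sqrt (2 |a|) / 2) (2 k q)
    (2 / k) and the Legendre term (sqrt (2 |a|) / 2) (2 q), together 3 sqrt 2 sqrt |a| q. The
    modulus term gives the second summand. *)
Lemma kernel_difference (m : nat) :
  Cmod (c0 theta h a * Rker (varkappa theta h a) (mu theta h a) m - sd_conv_kernel a m)
  <= (3 * sqrt 2 / Cmod at_
      + 1 / (Rabs (2 * INR m - 1) * (sqrt (Cmod at_) + sqrt 2)))
     * eps * (Cmod a * sqrt (Cmod a)).
Proof.
  unfold sd_conv_kernel. rewrite !Rker_leg_coef, !varkappa_half_cis, !c0_half_cis.
  rewrite half_cis_alpha_hat, !alpha_hat_quarter, (mu_quarter 1 a Ha).
  rewrite alpha_hat_factor, !Cmod_mult, (Cmod_R 2), (Rabs_pos_eq 2) by lra.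
  rewrite !sqrt_mult by lra.
  set (s := half_cis (2 * a)). assert (Hs : Cmod s = 1) by apply Cmod_half_cis.
  assert (Hw : Cmod w = 1) by apply Cmod_half_cis.
  set (x := mu theta h a). set (y := Re a / Cmod a).
  pose proof mu_bound as Hx. fold x in Hx.
  pose proof mu_diff as Hxy. fold x y in Hxy.
  assert (Hy : Rabs y <= 1).
  { unfold y, Rdiv. rewrite Rabs_mult, Rabs_inv, (Rabs_pos_eq (Cmod a)) by lra.
    apply (Rmult_le_reg_r (Cmod a)); [exact HM|].
    rewrite Rmult_assoc, Rinv_l, Rmult_1_r, Rmult_1_l by lra. apply re_le_Cmod. }
  set (r := leg_coef x m). set (r' := leg_coef y m).
  assert (Hr : Rabs (2 * INR m - 1) * Rabs r <= 2) by now apply leg_coef_bound.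
  assert (Hrr : Rabs (r - r') <= 2 * (eps * Cmod a / Cmod at_)).
  { eapply Rle_trans; [now apply leg_coef_lipschitz | exact Hxy]. }
  pose proof half_direction_alpha_tilde as Hw1.
  set (sg := (Cconj s * (- (s * s)) ^ m)%C).
  assert (Hsg : Cmod sg = 1).
  { unfold sg. rewrite Cmod_mult, Cmod_conj, Cmod_pow, Cmod_opp, Cmod_mult, Hs.
    rewrite !Rmult_1_l. apply pow1. }
  set (v := (Cconj w * (w * w) ^ m)%C).
  assert (Hv : Cmod v = 1).
  { unfold v. rewrite Cmod_mult, Cmod_conj, Cmod_pow, Cmod_mult, Hw.
    rewrite !Rmult_1_l. apply pow1. }
  pose proof (unit_odd_pow_minus_1 w m Hw) as Hv1. fold v in Hv1.
  set (A := Cmod at_) in *. set (M := Cmod a) in *.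
  set (sA := sqrt A). set (sM := sqrt M). set (s2 := sqrt 2).
  assert (HsA : 0 < sA) by now apply sqrt_lt_R0.
  assert (HsM : 0 < sM) by now apply sqrt_lt_R0.
  assert (Hs2 : 0 < s2) by (apply sqrt_lt_R0; lra).
  assert (Hsd : Rabs (sA - s2) * (sA + s2) <= eps * M).
  { rewrite <- (Rabs_pos_eq (sA + s2)) by lra. rewrite <- Rabs_mult.
    replace ((sA - s2) * (sA + s2)) with (sA * sA - s2 * s2) by ring.
    unfold sA, s2. rewrite !sqrt_sqrt by lra. apply Cmod_alpha_tilde_minus_2. }
  (* The unimodular factor [sg] is common; then the moduli, the phases and the Legendre factors are
     exchanged one at a time. *)
  replace (_ - _)%C with
    (sg * (RtoC (- (sM * (sA - s2) / 2)) * v * RtoC r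
       + RtoC (- (s2 * sM / 2)) * (v - 1) * RtoC r
       + RtoC (- (s2 * sM / 2)) * RtoC (r - r')))%C.
  2:{ replace ((- (s * w * (s * w))) ^ m)%C with ((- (s * s)) ^ m * (w * w) ^ m)%C.
      2:{ rewrite <- Cpow_mult_l. f_equal. ring. }
      rewrite Cmult_conj. unfold sg, v.
      replace (RtoC (- (sM * (sA - s2) / 2))) with (RtoC (- (sM * sA / 2)) - RtoC (- (s2 * sM / 2)))%C
        by (rewrite <- RtoC_minus; f_equal; field).
      rewrite RtoC_minus. ring. }
  rewrite Cmod_mult, Hsg, Rmult_1_l.
  eapply Rle_trans; [eapply Rle_trans; [apply Cmod_triangle|];
    apply Rplus_le_compat_r, Cmod_triangle|].
  rewrite !Cmod_mult, !Cmod_R, Hv, !Rabs_Ropp.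
  unfold Rdiv at 1 2 3. rewrite !Rabs_mult, (Rabs_pos_eq sM), (Rabs_pos_eq s2), (Rabs_pos_eq (/ 2)) by lra.
  set (k := Rabs (2 * INR m - 1)) in *.
  assert (Hk : 0 < k) by (apply Rabs_pos_lt, odd_neq0).
  set (q := eps * M / A) in *.
  assert (T1 : sM * Rabs (sA - s2) * / 2 * 1 * Rabs r <= 1 / (k * (sA + s2)) * eps * (M * sM)).
  { assert (U1 : Rabs (sA - s2) <= eps * M / (sA + s2)).
    { apply (Rmult_le_reg_r (sA + s2)); [lra|]. unfold Rdiv.
      rewrite Rmult_assoc, Rinv_l; lra. }
    assert (U2 : Rabs r <= 2 / k).
    { apply (Rmult_le_reg_r k); [lra|]. unfold Rdiv. rewrite Rmult_assoc, Rinv_l; lra. }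
    replace (1 / (k * (sA + s2)) * eps * (M * sM))
      with (sM * / 2 * ((eps * M / (sA + s2)) * (2 / k))) by (field; lra).
    replace (sM * Rabs (sA - s2) * / 2 * 1 * Rabs r)
      with (sM * / 2 * (Rabs (sA - s2) * Rabs r)) by ring.
    apply Rmult_le_compat_l; [lra|].
    apply Rmult_le_compat; [apply Rabs_pos | apply Rabs_pos | exact U1 | exact U2]. }
  assert (T2 : s2 * sM * / 2 * Cmod (v - 1) * Rabs r <= 2 * s2 * sM * q).
  { replace (2 * s2 * sM * q) with (s2 * sM * / 2 * (2 * (2 * q))) by field.
    rewrite Rmult_assoc. apply Rmult_le_compat_l.
    { repeat apply Rmult_le_pos; lra. }
    pose proof (Cmod_ge_0 (w - 1)). pose proof (Rabs_pos r).
    apply Rle_trans with (k * Cmod (w - 1) * Rabs r); [now apply Rmult_le_compat_r|].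
    replace (k * Cmod (w - 1) * Rabs r) with (k * Rabs r * Cmod (w - 1)) by ring.
    apply Rmult_le_compat; try lra. apply Rmult_le_pos; lra. }
  assert (T3 : s2 * sM * / 2 * Rabs (r - r') <= s2 * sM * q).
  { replace (s2 * sM * q) with (s2 * sM * / 2 * (2 * q)) by field.
    apply Rmult_le_compat_l; [repeat apply Rmult_le_pos; lra | exact Hrr]. }
  replace ((3 * s2 / A + 1 / (k * (sA + s2))) * eps * (M * sM))
    with (3 * s2 * sM * q + 1 / (k * (sA + s2)) * eps * (M * sM)) by (unfold q; field; lra).
  lra.
Qed.
End Error.

(** * The error bound and its uniform consequence *)

Lemma Rpower_3_2 (x : R) : 0 < x -> Rpower x (3 / 2) = x * sqrt x.
Proof.
  intros Hx. replace (3 / 2) with (1 + / 2) by field.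
  now rewrite Rpower_plus, Rpower_1, Rpower_sqrt.
Qed.

Theorem proposition3 (hbar rho B V X : R)
    (Hhbar : 0 < hbar) (Hrho : 0 < rho) (HB : 0 < B) (HX : 0 < X) :
  (forall theta h tau : R, theta <= 1 / 4 -> 0 < h -> 0 < tau ->
     forall m : nat,
       let a := ahat hbar rho B V tau in
       let at_ := alpha_tilde theta h a in
       kernel_error theta h hbar rho B V tau X m
       <= (3 * sqrt 2 / Cmod at_
           + 1 / (Rabs (2 * INR m - 1) * (sqrt (Cmod at_) + sqrt 2)))
          * (1 - 4 * theta) * h ^ 2 * Rpower (Cmod a) (3 / 2))
  /\
  (forall tau0 : R, 0 < tau0 ->
     exists K delta : R, 0 < delta /\
       forall theta h tau : R, theta <= 1 / 4 -> 0 < h -> 0 < tau -> tau <= tau0 ->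
         (1 - 4 * theta) * h ^ 2 / tau < delta ->
         Rbar_le
           (Sup_seq (fun m => Finite (kernel_error theta h hbar rho B V tau X m)))
           (Finite (K * ((1 - 4 * theta) * (h ^ 2 / Rpower tau (3 / 2)))))).
Proof.
  assert (Hbound : forall theta h tau : R, theta <= 1 / 4 -> 0 < h -> 0 < tau ->
     forall m : nat,
       let a := ahat hbar rho B V tau in
       let at_ := alpha_tilde theta h a in
       kernel_error theta h hbar rho B V tau X m
       <= (3 * sqrt 2 / Cmod at_
           + 1 / (Rabs (2 * INR m - 1) * (sqrt (Cmod at_) + sqrt 2)))
          * (1 - 4 * theta) * h ^ 2 * Rpower (Cmod a) (3 / 2)).
  { intros theta h tau Hth Hh Ht m a at_.
    assert (Him : 0 < Im a) by now apply ahat_Im.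
    unfold kernel_error. fold a. rewrite sd_kernel_value by assumption. fold a.
    rewrite Rpower_3_2 by now apply Cmod_gt_0, Im_pos_neq0.
    rewrite (Rmult_assoc _ (1 - 4 * theta)). now apply kernel_difference. }
  split; [exact Hbound|]. intros tau0 Ht0.
  set (b0 := Rabs (V / (hbar ^ 2 * B))). set (b1 := 2 * rho / (hbar * B)).
  assert (Hb0 : 0 <= b0) by apply Rabs_pos.
  assert (Hb1 : 0 < b1) by (apply Rdiv_lt_0_compat; [lra | now apply Rmult_lt_0_compat]).
  (* Bounds |a| tau for all tau <= tau0, which converts |a|^(3/2) into tau^(-3/2). *)
  set (L := b0 * tau0 + b1).
  assert (HL : 0 < L) by (unfold L; nra).
  (* The choice delta = 1 / L forces eps |a| <= 1, hence |at_| >= 1. The bracket is then at most 3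
     sqrt 2 + 1, as |2m - 1| >= 1 for every m. *)
  exists ((3 * sqrt 2 + 1) * (L * sqrt L)), (/ L).
  split; [now apply Rinv_0_lt_compat|].
  intros theta h tau Hth Hh Ht Htt Hd.
  set (a := ahat hbar rho B V tau) in *.
  assert (Him : 0 < Im a) by now apply ahat_Im.
  assert (HaL : Cmod a * tau <= L).
  { assert (E : Cmod a <= b0 + b1 / tau).
    { replace a with (RtoC (V / (hbar ^ 2 * B)) + Ci * RtoC (b1 / tau))%C.
      - eapply Rle_trans; [apply Cmod_triangle|].
        rewrite Cmod_mult, Cmod_Ci, !Cmod_R, (Rabs_pos_eq (b1 / tau)).
        + fold b0. lra.
        + left. now apply Rdiv_lt_0_compat.
      - unfold a, ahat, b1. apply C_ext; cbn; field; lra. }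
    apply Rle_trans with ((b0 + b1 / tau) * tau); [apply Rmult_le_compat_r; lra|].
    unfold L. replace ((b0 + b1 / tau) * tau) with (b0 * tau + b1) by (field; lra). nra. }
  assert (HM : 0 < Cmod a) by now apply Cmod_gt_0, Im_pos_neq0.
  set (eps := (1 - 4 * theta) * h ^ 2) in *.
  assert (Heps : 0 <= eps).
  { unfold eps. apply Rmult_le_pos; [lra | apply pow2_ge_0]. }
  assert (HeM : eps * Cmod a <= 1).
  { assert (E1 : eps / tau * L <= 1).
    { apply Rle_trans with (/ L * L); [apply Rmult_le_compat_r; lra|]. rewrite Rinv_l; lra. }
    apply Rle_trans with (eps / tau * (Cmod a * tau)).
    - right. field. lra.
    - eapply Rle_trans; [|exact E1]. apply Rmult_le_compat_l; [|exact HaL].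
      apply Rdiv_le_0_compat; lra. }
  pose proof (Cmod_alpha_tilde_minus_2 theta h a Hth) as HA. fold eps in HA.
  apply Rabs_le_between in HA.
  set (A := Cmod (alpha_tilde theta h a)) in *.
  assert (HA1 : 1 <= A) by lra.
  replace ((1 - 4 * theta) * (h ^ 2 / Rpower tau (3 / 2))) with (eps / (tau * sqrt tau)).
  2:{ rewrite Rpower_3_2 by exact Ht. unfold eps, Rdiv. ring. }
  assert (Hst : 0 < sqrt tau) by now apply sqrt_lt_R0.
  assert (Hs2 : 1 <= sqrt 2) by (rewrite <- sqrt_1; apply sqrt_le_1; lra).
  assert (Hpow : Cmod a * sqrt (Cmod a) * (tau * sqrt tau) <= L * sqrt L).
  { replace (Cmod a * sqrt (Cmod a) * (tau * sqrt tau))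
      with ((Cmod a * tau) * (sqrt (Cmod a) * sqrt tau)) by ring.
    rewrite <- sqrt_mult by lra. apply Rmult_le_compat.
    - apply Rmult_le_pos; lra.
    - apply sqrt_pos.
    - exact HaL.
    - apply sqrt_le_1; [apply Rmult_le_pos; lra | lra | exact HaL]. }
  assert (Hm : forall m, kernel_error theta h hbar rho B V tau X m
    <= (3 * sqrt 2 + 1) * (L * sqrt L) * (eps / (tau * sqrt tau))).
  { intros m. eapply Rle_trans; [now apply Hbound|]. fold a. fold A.
    rewrite (Rmult_assoc _ (1 - 4 * theta)). fold eps. rewrite Rpower_3_2 by exact HM.
    assert (Hk : 1 <= Rabs (2 * INR m - 1)).
    { destruct m as [|m].
      - cbn [INR]. rewrite Rabs_left by lra. lra.
      - rewrite S_INR. pose proof (pos_INR m). rewrite Rabs_pos_eq; lra. }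
    pose proof (sqrt_pos A) as HsA.
    assert (F1 : 3 * sqrt 2 / A <= 3 * sqrt 2).
    { apply (Rmult_le_reg_r A); [lra|]. unfold Rdiv. rewrite Rmult_assoc, Rinv_l by lra.
      apply Rmult_le_compat_l; lra. }
    assert (F2 : 1 / (Rabs (2 * INR m - 1) * (sqrt A + sqrt 2)) <= 1).
    { assert (P : 1 <= Rabs (2 * INR m - 1) * (sqrt A + sqrt 2)).
      { rewrite <- (Rmult_1_r 1) at 1. apply Rmult_le_compat; lra. }
      apply (Rmult_le_reg_r (Rabs (2 * INR m - 1) * (sqrt A + sqrt 2))); [lra|].
      unfold Rdiv. rewrite Rmult_assoc, Rinv_l by lra. lra. }
    assert (F0 : 0 <= Cmod a * sqrt (Cmod a)).
    { apply Rmult_le_pos; [lra | apply sqrt_pos]. }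
    apply Rle_trans with ((3 * sqrt 2 + 1) * eps * (Cmod a * sqrt (Cmod a))).
    - apply Rmult_le_compat_r; [exact F0|]. apply Rmult_le_compat_r; lra.
    - assert (Hts : 0 < tau * sqrt tau) by now apply Rmult_lt_0_compat.
      replace ((3 * sqrt 2 + 1) * (L * sqrt L) * (eps / (tau * sqrt tau)))
        with ((3 * sqrt 2 + 1) * eps * (L * sqrt L / (tau * sqrt tau))) by (field; lra).
      apply Rmult_le_compat_l; [apply Rmult_le_pos; lra|].
      apply (Rmult_le_reg_r (tau * sqrt tau)); [exact Hts|].
      unfold Rdiv. rewrite (Rmult_assoc (L * _)), Rinv_l, Rmult_1_r by lra. exact Hpow. }
  apply Rbar_not_lt_le. intros Hlt. apply Sup_seq_minor_lt in Hlt.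
  destruct Hlt as [m Hlt]. specialize (Hm m). cbn in Hlt. lra.
Qed.
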